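(* Let $d\in\{1,2,3\}$, $\Omega=[-\pi,\pi]^d$ with periodic boundary conditions, and let $f:\mathbb{R}\to\mathbb{R}$ be a function for which there is a constant $\kappa>0$ with $\sup_{\xi\in\mathbb{R}}|f'(\xi)|\le\kappa$. Let $1\le p\le\infty$ and $w^0,v^0\in L^p(\Omega)$. Let $$\mathcal{S}^{[k]}(\tau)=\sum_{i=1}^{M}c_i\,\mathcal{E}_B(b_{i,m_i}\tau)\,\mathcal{E}_A(a_{i,m_i}\tau)\cdots\mathcal{E}_B(b_{i,1}\tau)\,\mathcal{E}_A(a_{i,1}\tau)$$ be a multi-product expansion splitting operator with real weights $c_i$ (possibly negative) and real step coefficients satisfying $a_{i,j}\ge0$, $b_{i,j}\ge0$, $\sum_{i=1}^{M}c_i=1$, and $\sum_{j=1}^{m_i}a_{i,j}=1$ for every $1\le i\le M$. Then $$\left\|\mathcal{S}^{[k]}(\tau)w^0-\mathcal{S}^{[k]}(\tau)v^0\right\|_p\le \mathrm{e}^{C\tau}\left\|w^0-v^0\right\|_p\qquad\text{for all }\tau>0,$$ where $C=(\widetilde{c}+1)\kappa b$, $\widetilde{c}=\sum_{i=1}^{M}|c_i|$, and $b=\max_{1\le i\le M}\left\{\sum_{j=1}^{m_i}b_{i,j}\right\}$. Moreover, for any $T>0$ and any $\tau>0$ and positive integer $n$ with $0<n\tau\le T$, $$\left\|\left[\mathcal{S}^{[k]}(\tau)\right]^n w^0\right\|_p\le \mathrm{e}^{\widetilde{c}\kappa bT}\left(\left\|w^0\right\|_p+\frac{|\Omega|^{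1/p}|f(0)|}{\kappa}\right).$$
   Context: $\mathcal{E}_A(t)=\mathrm{e}^{t\Delta}$, $t\ge0$, is the heat semigroup on $\Omega$ with periodic boundary conditions (solution operator of $u_t=\Delta u$). $\mathcal{E}_B(t)$ is the solution operator of $w_t=f(w)$, applied pointwise in $x$: $(\mathcal{E}_B(t)w^0)(x)=w(x,t)$ where $\partial_t w(x,t)=f(w(x,t))$, $w(x,0)=w^0(x)$. $M$ and $m_i$ are positive integers. In each product the rightmost operator is applied first, and $[\mathcal{S}^{[k]}(\tau)]^n$ denotes the $n$-fold composition. The superscript $[k]$ is a label for the order of the method; the conditions on the coefficients used in this statement are exactly those listed. $\|\cdot\|_p$ is the $L^p(\Omega)$ norm, $|\Omega|$ is the volume of $\Omega$, and $|\Omega|^{1/\infty}=1$ by convention. *)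

(* Defs.v *)
From HB Require Import structures.
From mathcomp Require Import all_boot all_order all_algebra.
From mathcomp Require Import all_classical all_reals all_analysis.
Set Implicit Arguments.
Unset Strict Implicit.
Unset Printing Implicit Defensive.
Import Order.TTheory GRing.Theory Num.Theory.
Import numFieldNormedType.Exports.
Local Open Scope classical_set_scope.
Local Open Scope ring_scope.

(* Row vectors carry the sigma-algebra generated by the coordinates, as the
   library does for tuples; over the reals it is the Borel sigma-algebra. *)
Section measurable_row.
Context {disp : measure_display} {T : measurableType disp} (n : nat).

Let coord : 'I_n -> 'rV[T]_n -> T := fun i x => x ord0 i.

Let row_set0 : g_sigma_preimage coord set0.
Proof. exact: sigma_algebra0. Qed.

Let row_setC A : g_sigma_preimage coord A -> g_sigma_preimage coord (~` A).
Proof. exact: sigma_algebraC. Qed.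

Let row_bigcup (F : _^nat) : (forall i, g_sigma_preimage coord (F i)) ->
  g_sigma_preimage coord (\bigcup_i (F i)).
Proof. exact: sigma_algebra_bigcup. Qed.

HB.instance Definition _ := @isMeasurable.Build (measure_tuple_display disp)
  'rV[T]_n (g_sigma_preimage coord) row_set0 row_setC row_bigcup.

End measurable_row.

Lemma measurable_coord (disp : measure_display) (T : measurableType disp)
    (n : nat) (i : 'I_n) :
  measurable_fun [set: 'rV[T]_n] (fun x : 'rV[T]_n => x ord0 i).
Proof.
move=> _ Y mY; rewrite setTI; apply: sub_sigma_algebra => /=.
rewrite -bigcup_seq/=; exists i => /=; first by rewrite mem_index_enum.
by exists Y => //; rewrite setTI.
Qed.

Lemma measurable_fun_rowP (disp disp' : measure_display)
    (U : measurableType disp) (T : measurableType disp') (n : nat)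
    (g : U -> 'rV[T]_n) :
  (forall i, measurable_fun [set: U] (fun x => g x ord0 i)) ->
  measurable_fun [set: U] g.
Proof.
move=> mg.
have: g_sigma_preimage (fun i => (fun x : 'rV[T]_n => x ord0 i) \o g)
    `<=` measurable.
  apply: smallest_sub; first exact: sigma_algebra_measurable.
  case: n => [|n] in g mg *; first by rewrite big_ord0.
  rewrite -bigcup_mkord_ord; apply: bigcup_sub => i Ii.
  by move=> A [B mB <-]; exact: mg.
rewrite g_sigma_preimage_comp => pS _ A mA.
by apply: pS; exists A.
Qed.

Section torus_measure.
Context {R : realType}.

Definition row_cons (n : nat) (x : measurableTypeR R * 'rV[R]_n) : 'rV[R]_n.+1 :=
  \row_j if unlift ord0 j is Some i then x.2 ord0 i else x.1.

Lemma measurable_row_cons (n : nat) : measurable_fun setT (@row_cons n).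
Proof.
apply: measurable_fun_rowP => j.
under eq_fun do rewrite mxE.
case: unliftP => [i _|_]; last exact: measurable_fst.
exact: (measurableT_comp (measurable_coord i) measurable_snd).
Qed.

HB.instance Definition _ (n : nat) :=
  isMeasurableFun.Build _ _ _ _ (@row_cons n) (@measurable_row_cons n).

Let Ipi : set R := [set` `[- pi, pi]].

Lemma lebesgue_measure_segment : lebesgue_measure Ipi = (2 * pi)%:E.
Proof.
rewrite /Ipi lebesgue_measure_itv/= lte_fin gt0_cp ?pi_gt0//.
by rewrite -EFinD opprK mulr_natl mulr2n.
Qed.

Let lebesgue_segment_fin : (lebesgue_measure Ipi < +oo)%E.
Proof. by rewrite lebesgue_measure_segment ltry. Qed.

Definition segment_measure : {finite_measure set (measurableTypeR R) -> \bar R} :=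
  @mfrestr _ (measurableTypeR R) R Ipi lebesgue_measure
    (measurable_itv `[- pi, pi]) lebesgue_segment_fin.

Definition cons_measure (n : nat) (m : {finite_measure set 'rV[R]_n -> \bar R})
    : set 'rV[R]_n.+1 -> \bar R :=
  pushforward (segment_measure \x m)%E (@row_cons n).

Section cons_measure_finite.
Context (n : nat) (m : {finite_measure set 'rV[R]_n -> \bar R}).

Let cons_measure0 : cons_measure m set0 = 0%E.
Proof. exact: measure0. Qed.

Let cons_measure_ge0 A : (0 <= cons_measure m A)%E.
Proof. exact: measure_ge0. Qed.

Let cons_measure_sigma_additive : semi_sigma_additive (cons_measure m).
Proof. exact: measure_semi_sigma_additive. Qed.

HB.instance Definition _ := isMeasure.Build _ _ _ (cons_measure m)
  cons_measure0 cons_measure_ge0 cons_measure_sigma_additive.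

Let cons_measure_fin : fin_num_fun (cons_measure m).
Proof.
apply: lty_fin_num_fun.
rewrite /= /cons_measure /pushforward preimage_setT -setXTT.
rewrite [ltLHS]product_measure1E// lte_mul_pinfty//.
  exact: fin_num_measure.
by rewrite -ge0_fin_numE ?fin_num_measure.
Qed.

HB.instance Definition _ :=
  Measure_isFinite.Build _ _ _ (cons_measure m) cons_measure_fin.

End cons_measure_finite.

(* Lebesgue measure on [-pi, pi]^d, as the d-fold product of Lebesgue measure
   on [-pi, pi]. It is a measure on the whole of R^d carried by the cube, so
   that L^p([-pi, pi]^d) is the library's L^p space of this measure. *)
Fixpoint torus_measure (d : nat) : {finite_measure set 'rV[R]_d -> \bar R} :=
  if d is n.+1 then cons_measure (torus_measure n) else \d_(0 : 'rV[R]_0).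

Lemma torus_measure_box (d : nat) (A : 'I_d -> set R) :
  (forall i, measurable (A i)) ->
  torus_measure d [set x : 'rV[R]_d | forall i, A i (x ord0 i)] =
  (\prod_(i < d) lebesgue_measure (A i `&` Ipi))%E.
Proof.
elim: d A => [|d IHd] A mA /=.
  rewrite big_ord0 diracE mem_set// => i; by case: i.
rewrite big_ord_recl -(IHd (fun i => A (lift ord0 i))); last by move=> i; exact: mA.
pose B : set 'rV[R]_d := [set x | forall i, A (lift ord0 i) (x ord0 i)].
change ((cons_measure (torus_measure d)) [set x | forall i, A i (x ord0 i)] = lebesgue_measure (A ord0 `&` Ipi) * torus_measure d B)%E.
have mB : measurable B.
  rewrite (_ : B = \bigcap_(i in [set: 'I_d])
      ((fun x : 'rV[R]_d => x ord0 i) @^-1` A (lift ord0 i))).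
    apply: fin_bigcap_measurable => // i _.
    by rewrite -[X in measurable X]setTI; exact: measurable_coord.
  by apply/seteqP; split=> x /= Bx; [move=> i _|move=> i]; exact: Bx.
have consE : @row_cons d @^-1` [set x | forall i, A i (x ord0 i)] = A ord0 `*` B.
  apply/seteqP; split=> [[a x] /= Aax|[a x] /= [Aa Bx] i].
    split=> [|i]; first by have := Aax ord0; rewrite mxE unlift_none.
    by have := Aax (lift ord0 i); rewrite mxE liftK.
  by rewrite mxE; case: unliftP => [j ->|->].
rewrite /cons_measure /pushforward.
transitivity ((segment_measure \x torus_measure d)%E (A ord0 `*` B)).
  exact: (congr1 (segment_measure \x torus_measure d)%E consE).
apply: etrans; first by apply: product_measure1E; [exact: mA|exact: mB].
by [].
Qed.

End torus_measure.

Definition Lp_norm {R : realType} {d : nat} (p : \bar R) (v : 'rV[R]_d -> R)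
    : \bar R :=
  Lnorm (torus_measure d) p (EFin \o v).

(* |Omega| ^ (1/p), with the convention |Omega| ^ (1/oo) = 1 *)
Definition volume_root {R : realType} (d : nat) (p : \bar R) : R :=
  if p is q%:E then fine (torus_measure d [set: 'rV[R]_d]) `^ q^-1 else 1.

Section pde.
Context {R : realType} {d : nat}.
Implicit Types (u : R -> 'rV[R]_d -> R) (v w : 'rV[R]_d -> R).

Definition pderiv (i : 'I_d) v : 'rV[R]_d -> R := 'D_(delta_mx ord0 i) v.

Definition laplacian v : 'rV[R]_d -> R :=
  fun x => \sum_(i < d) pderiv i (pderiv i v) x.

Definition periodic v := forall x i, v (x + (2 * pi) *: delta_mx ord0 i) = v x.

(* [u] is continuously differentiable in time and twice continuously
   differentiable in space, for positive times. *)
Definition C12 u := forall t x, 0 < t ->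
  [/\ derivable (u^~ x) t 1,
      forall i, derivable (u t) x (delta_mx ord0 i) &
      forall i j, derivable (pderiv i (u t)) x (delta_mx ord0 j)] /\
  [/\ {for (t, x), continuous (fun z : R * 'rV[R]_d => u z.1 z.2)},
      {for (t, x), continuous (fun z : R * 'rV[R]_d => derive1 (u^~ z.2) z.1)},
      forall i,
        {for (t, x), continuous (fun z : R * 'rV[R]_d => pderiv i (u z.1) z.2)} &
      forall i j, {for (t, x), continuous
        (fun z : R * 'rV[R]_d => pderiv j (pderiv i (u z.1)) z.2)}].

(* The solution of the periodic heat equation with initial value [v]: classical
   for positive times (the heat flow is smoothing), the initial value being
   attained in L^1. This is the mode of convergence available for all data in
   L^p, 1 <= p <= oo; attainment in L^oo would fail for discontinuous [v]. *)
Definition heat_solution v u :=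
  [/\ u 0 = v,
      forall t, 0 < t -> periodic (u t),
      C12 u,
      forall t x, 0 < t -> derive1 (u^~ x) t = laplacian (u t) x &
      Lp_norm 1 (u t \- v) @[t --> 0^'+] --> 0%E].

(* [EA] is the solution operator of the periodic heat equation. It is specified
   on L^1, which contains L^p for every p >= 1, the domain having finite
   measure; the equation determines [EA t v] for all t >= 0. *)
Definition heat_semigroup (EA : R -> ('rV[R]_d -> R) -> ('rV[R]_d -> R)) :=
  forall v, v \in Lfun (torus_measure d) 1 -> heat_solution v (EA^~ v).

Definition ode_solution (f : R -> R) (y0 : R) (y : R -> R) :=
  [/\ y 0 = y0, {within `[0, +oo[, continuous y} &
      forall t : R, 0 < t -> is_derive t 1 y (f (y t))].

(* [EB] is the solution operator of w_t = f(w), applied at each point [x]. *)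
Definition pointwise_flow (f : R -> R)
    (EB : R -> ('rV[R]_d -> R) -> ('rV[R]_d -> R)) :=
  forall w x, ode_solution f (w x) (fun t => EB t w x).

Section splitting.
Variables (EA EB : R -> ('rV[R]_d -> R) -> ('rV[R]_d -> R)).

(* EB(b_m tau) EA(a_m tau) ... EB(b_1 tau) EA(a_1 tau), rightmost factor first *)
Definition split_product (m : nat) (a b : 'I_m -> R) (tau : R) w :=
  foldl (fun v j => EB (b j * tau) (EA (a j * tau) v)) w (enum 'I_m).

Definition multi_product (M : nat) (m : 'I_M -> nat) (c : 'I_M -> R)
    (a b : forall i, 'I_(m i) -> R) (tau : R) w : 'rV[R]_d -> R :=
  fun x => \sum_(i < M) c i * split_product (a i) (b i) tau w x.

End splitting.
End pde.

(* Main.v *)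
Require Import Defs.
From mathcomp Require Import all_boot all_order all_algebra.
From mathcomp Require Import all_classical all_reals all_analysis.
From mathcomp Require Import measurable_realfun ess_sup_inf.
From mathcomp Require Import ring lra.
Set Implicit Arguments.
Unset Strict Implicit.
Unset Printing Implicit Defensive.
Import Order.TTheory GRing.Theory Num.Theory.
Import numFieldNormedType.Exports.
Local Open Scope classical_set_scope.
Local Open Scope ring_scope.

(** The heat semigroup E_A does not increase any L^p norm; the reaction flow
    E_B(t) moves each value y by at most (exp(kappa t) - 1)(|y| + |f(0)|/kappa),
    and it changes the difference of two values by at most exp(kappa t) - 1
    times their distance ([gronwall_increment]). A naive estimate of the
    expansion, product by product, would give the factor
    ctilde * exp(kappa b tau), which does not tend to 1 with tau when some
    weight is negative. Instead each product is compared with the pure heat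
    flow E_A(tau): as its heat steps add up to tau, induction along its
    factors ([tracks_heat], [tracks_reaction]) shows that it grows by at most
    exp(kappa b tau) and deviates from E_A(tau) by at most
    exp(kappa b tau) - 1. As the weights sum to 1, the expansion is E_A(tau)
    plus the weighted deviations, so that its growth factor is at most
    1 + ctilde (exp(kappa b tau) - 1) <= exp(ctilde kappa b tau)
    ([tracks_combination], [bernoulli_expR]). The same induction serves both
    estimates: it runs on the difference of two trajectories for the first
    and, with norms shifted by |Omega|^(1/p) |f(0)|/kappa, on a single
    trajectory for the second, where it is iterated n times.

    The contraction property of the heat flow is derived from the equation
    and from the attainment of the initial value in L^1. For a convex phi
    with bounded derivative, the divergence theorem on the torus
    ([integral_periodic_derive]) makes the integral of phi(u(t)) nonincreasing
    for t > 0 ([entropy_nonincreasing]); as phi is Lipschitz, convergence in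
    L^1 extends this to t = 0 ([entropy_le_initial]). Taking phi the identity
    bounds the mass; taking phi a smoothed negative part shows that a
    nonnegative initial value stays nonnegative ([heat_flow_ge0]). These two
    facts give the L^p bound by Jensen's argument
    ([heat_flow_Lp_contraction]): the solution U issued from |v|^p exists
    since |v|^p is integrable, it dominates |u|^p because it dominates every
    affine function of |u| lying below |u|^p at time 0, and its mass does not
    increase. *)

(** * Continuous functions on the torus *)

Lemma measurable_mx_ball (R : realType) (n : nat) (x : 'rV[R]_n) (e : R) :
  0 < e -> measurable (ball x e).
Proof.
move=> e0.
have -> : ball x e = \bigcap_(i in [set: 'I_n])
    ((fun y : 'rV[R]_n => y ord0 i) @^-1` ball (x ord0 i) e).
  apply/seteqP; split=> y /=; first by case=> _ xy i _; exact: xy.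
  by move=> xy; split=> // i j; rewrite (ord1 i); exact: xy.
apply: fin_bigcap_measurable => // i _.
rewrite -[X in measurable X]setTI; apply: measurable_coord => //.
by apply: open_measurable; exact: ball_open.
Qed.

(** The balls with rational centre and radius 1 / (k + 1) form a countable
    base of the topology, and each is a finite intersection of coordinate
    conditions. *)
Lemma open_measurable_row (R : realType) (n : nat) (U : set 'rV[R]_n) :
  open U -> measurable U.
Proof.
move=> oU.
pose c (q : 'rV[rat]_n) : 'rV[R]_n := map_mx ratr q.
pose B (qk : 'rV[rat]_n * nat) := ball (c qk.1) (qk.2.+1%:R^-1 : R).
have -> : U = \bigcup_(qk in [set qk | B qk `<=` U]) B qk.
  apply/seteqP; split=> [x Ux|x [qk /= + Bx]]; last exact.
  have : nbhs x U by exact: open_nbhs_nbhs.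
  move=> /nbhs_ballP[e /= e0 eU].
  have [k ke] : exists k : nat, k.+1%:R^-1 < e / 2.
    exists (Num.truncn (e / 2)^-1).
    by rewrite invf_plt ?posrE ?divr_gt0 ?ltr0n ?truncnS_gt.
  have k0 : (0 : R) < k.+1%:R^-1 by rewrite invr_gt0 ltr0n.
  have /choice[q qx] : forall i : 'I_n, exists q : rat,
      ball (x ord0 i) k.+1%:R^-1 (ratr q : R).
    move=> i.
    have [|q] := @rat_in_itvoo R (x ord0 i - k.+1%:R^-1)
                                 (x ord0 i + k.+1%:R^-1).
      by rewrite ltrD2l gt0_cp.
    by rewrite in_itv/= => qx; exists q; rewrite -ball_normE/= distrC ltr_distl.
  have xq : ball (c (\row_i q i)) k.+1%:R^-1 x.
    split=> // i j; rewrite (ord1 i) /c !mxE.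
    exact/ball_sym.
  exists (\row_i q i, k) => //= y yq; apply: eU.
  apply: (@le_ball _ _ _ (k.+1%:R^-1 + k.+1%:R^-1)).
    by rewrite [leRHS]splitr lerD// ltW.
  exact: ball_triangle (ball_sym xq) yq.
rewrite bigcup_mkcond; apply: countable_bigcupT_measurable => // qk.
by case: ifPn => // _; apply: measurable_mx_ball; rewrite invr_gt0 ltr0n.
Qed.

Lemma continuous_measurable_row (R : realType) (n : nat) (g : 'rV[R]_n -> R) :
  continuous g -> measurable_fun setT g.
Proof.
move=> /continuousP cg; apply: (measurability _ (RGenOpens.measurableE R)).
move=> _ [_ [a [b ->] <-]]; rewrite setTI.
by apply: open_measurable_row; exact/cg/interval_open.
Qed.

Definition cube (R : realType) (n : nat) : set 'rV[R]_n :=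
  [set x | forall i, x ord0 i \in `[- pi, pi]].
Arguments cube R n : clear implicits.

Lemma cubeE (R : realType) (n : nat) :
  cube R n = [set x | forall i, [set` `[- pi, pi]] (x ord0 i)].
Proof. by []. Qed.

Lemma compact_cube (R : realType) (n : nat) : compact (cube R n).
Proof.
by rewrite cubeE; apply: (@rV_compact R n (fun=> _)) => i; exact: segment_compact.
Qed.

Lemma measurable_cube (R : realType) (n : nat) : measurable (cube R n).
Proof.
have -> : cube R n = \bigcap_(i in [set: 'I_n])
    ((fun y : 'rV[R]_n => y ord0 i) @^-1` [set` `[- pi, pi]]).
  by apply/seteqP; split=> y /= yQ; [move=> i _|move=> i]; exact: yQ.
apply: fin_bigcap_measurable => // i _.
by rewrite -[X in measurable X]setTI; apply: measurable_coord.
Qed.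

Lemma torus_measure_cube (R : realType) (n : nat) :
  torus_measure n (cube R n) = torus_measure n setT.
Proof.
have -> : [set: 'rV[R]_n] = [set x | forall i, [set: R] (x ord0 i)].
  by apply/seteqP; split.
rewrite cubeE (@torus_measure_box R n (fun=> _))//.
rewrite (@torus_measure_box R n (fun=> setT))//.
by apply: eq_bigr => i _; rewrite setIid setTI.
Qed.

Lemma torus_measure_setC_cube (R : realType) (n : nat) :
  torus_measure n (~` cube R n) = 0%E.
Proof.
rewrite -setTD measureD//; last 2 first.
- exact: measurable_cube.
- by rewrite -ge0_fin_numE// fin_num_measure.
rewrite setTI [X in (_ - X)%E]torus_measure_cube subee// fin_num_measure//.
Qed.

Lemma torus_measure_gt0 (R : realType) (n : nat) :
  (0 < torus_measure n [set: 'rV[R]_n])%E.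
Proof.
rewrite -torus_measure_cube cubeE (@torus_measure_box R n (fun=> _))//.
elim/big_ind: _ => // [x y|i _]; first exact: mule_gt0.
by rewrite setIid lebesgue_measure_segment lte_fin mulr_gt0// pi_gt0.
Qed.

Lemma continuous_bounded_cube (R : realType) (n : nat) (g : 'rV[R]_n -> R) :
  continuous g -> exists K, forall x, cube R n x -> `|g x| <= K.
Proof.
move=> cg.
have : compact (g @` cube R n).
  apply: continuous_compact; last exact: compact_cube.
  exact: continuous_subspaceT.
move=> /compact_bounded[K [Kr /(_ (K + 1))]].
rewrite ltrDl ltr01 => /(_ isT) gK; exists (K + 1) => x Qx.
by apply: gK; exists x.
Qed.

Lemma ae_cube (R : realType) (n : nat) :
  {ae torus_measure n, forall x : 'rV[R]_n, cube R n x}.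
Proof.
exists (~` cube R n); split => //.
- by apply: measurableC; exact: measurable_cube.
- exact: torus_measure_setC_cube.
Qed.

Lemma bounded_integrable (R : realType) (n : nat) (g : 'rV[R]_n -> R) (K : R) :
  measurable_fun setT g -> (forall x, cube R n x -> `|g x| <= K) ->
  (torus_measure n).-integrable setT (EFin \o g).
Proof.
move=> mg gK; apply/integrableP; split; first exact/measurable_EFinP.
apply: (@le_lt_trans _ _ (\int[torus_measure n]_x (cst `|K|%:E) x)%E).
  apply: ae_ge0_le_integral => //.
  - by apply: measurableT_comp => //; exact/measurable_EFinP.
  - by move=> x _; rewrite /= lee_fin.
  - apply: filterS (ae_cube R n) => x Qx _ /=.
    by rewrite lee_fin (le_trans (gK x Qx))// ler_norm.
rewrite integral_cst// lte_mul_pinfty// -ge0_fin_numE// fin_num_measure//.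
Qed.

Lemma continuous_integrable (R : realType) (n : nat) (g : 'rV[R]_n -> R) :
  continuous g -> (torus_measure n).-integrable setT (EFin \o g).
Proof.
move=> cg; have [K gK] := continuous_bounded_cube cg.
exact: bounded_integrable (continuous_measurable_row cg) gK.
Qed.

Lemma integral_cube (R : realType) (n : nat) (g : 'rV[R]_n -> \bar R) :
  (torus_measure n).-integrable setT g ->
  (\int[torus_measure n]_(x in cube R n) g x = \int[torus_measure n]_x g x)%E.
Proof.
move=> ig; rewrite [RHS](negligible_integral (measurableC (@measurable_cube R n)))//.
- by rewrite setTD setCK.
- exact: torus_measure_setC_cube.
Qed.

Lemma integral_segment_measure (R : realType) (g : R -> \bar R) :
  segment_measure.-integrable setT g ->
  (\int[segment_measure]_x g x =
   \int[lebesgue_measure]_(x in [set` `[- pi, pi]%R]) g x)%E.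
Proof.
move=> ig.
have mI : @measurable _ (measurableTypeR R) [set` `[- pi, pi : R]] by [].
rewrite (negligible_integral (measurableC mI))//; last first.
  by rewrite /= /mfrestr /mrestr setICl measure0.
rewrite setTD setCK; apply: eq_measure_integral => A mA AI.
by rewrite /= /mfrestr /mrestr setIidl.
Qed.

Lemma continuous_integrable_segment (R : realType) (g : R -> R) :
  continuous g -> segment_measure.-integrable setT (EFin \o g).
Proof.
move=> cg.
have mI : @measurable _ (measurableTypeR R) [set` `[- pi, pi : R]] by [].
have mg : measurable_fun setT (EFin \o g).
  by apply/measurable_EFinP; exact: continuous_measurable_fun.
apply/integrableP; split => //.
rewrite (ge0_negligible_integral (measurableC mI))//; last 2 first.
- exact: measurableT_comp.
- by rewrite /= /mfrestr /mrestr setICl measure0.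
rewrite setTD setCK (@eq_measure_integral _ _ _ _ lebesgue_measure); last first.
  by move=> A mA AI; rewrite /= /mfrestr /mrestr setIidl.
have /integrableP[] // : lebesgue_measure.-integrable `[- pi, pi] (EFin \o g).
apply: continuous_compact_integrable; first exact: segment_compact.
exact: continuous_subspaceT.
Qed.

Lemma is_derive_continuous (R : realType) (g dg : R -> R) :
  (forall x : R, is_derive x 1 g (dg x)) -> continuous g.
Proof.
move=> gdg x; apply/differentiable_continuous/derivable1_diffP.
by have [] := gdg x.
Qed.

Lemma integral_segment_derive (R : realType) (G dG : R -> R) :
  continuous dG -> (forall x : R, is_derive x 1 G (dG x)) ->
  (\int[segment_measure]_x (dG x)%:E = (G pi - G (- pi))%:E)%E.
Proof.
move=> cdG GdG; rewrite integral_segment_measure; last first.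
  exact: continuous_integrable_segment.
have cG := is_derive_continuous GdG.
rewrite (@continuous_FTC2 _ dG G).
- by rewrite EFinB.
- by rewrite gt0_cp// pi_gt0.
- exact: continuous_subspaceT.
- split.
  + by move=> x _; have [] := GdG x.
  + exact/cvg_at_right_filter/cG.
  + exact/cvg_at_left_filter/cG.
- by move=> x _; rewrite derive1E; have [_ ->] := GdG x.
Qed.

Lemma integrable_row_cons (R : realType) (n : nat) (g : 'rV[R]_n.+1 -> \bar R) :
  (torus_measure n.+1).-integrable setT g ->
  (segment_measure \x torus_measure n)%E.-integrable setT (g \o @row_cons R n).
Proof.
move=> /integrableP[mg ig].
have mgr : measurable_fun setT (g \o @row_cons R n).
  by apply: measurableT_comp => //; exact: measurable_row_cons.
apply/integrableP; split => //.
apply: le_lt_trans ig.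
rewrite -[X in (X <= _)%E]/(\int[segment_measure \x torus_measure n]_x
  ((abse \o g) \o @row_cons R n) x)%E.
have := @ge0_integral_pushforward _ _ _ _ R (@row_cons R n)
  (@measurable_row_cons R n) (segment_measure \x torus_measure n)%E setT
  (abse \o g).
rewrite preimage_setT => <- //; first exact: measurableT_comp.
by move=> x _ /=.
Qed.

Lemma integral_row_cons (R : realType) (n : nat) (g : 'rV[R]_n.+1 -> \bar R) :
  (torus_measure n.+1).-integrable setT g ->
  (\int[torus_measure n.+1]_x g x =
   \int[segment_measure \x torus_measure n]_z g (row_cons z))%E.
Proof.
move=> ig; have [mg _] := integrableP _ _ _ ig.
have := @integral_pushforward _ _ _ _ R (@row_cons R n)
  (@measurable_row_cons R n) (segment_measure \x torus_measure n)%E setT g mg.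
rewrite preimage_setT => <- //; exact: integrable_row_cons.
Qed.

(** A directional derivative sees only the restriction of the function to a
    line, so it can be computed along any line carrying the same values. *)
Lemma is_derive_line (R : realType) (V W : normedModType R) (f : V -> R)
    (g : W -> R) (x v : V) (y w : W) (l : R) :
  (forall h : R, g (h *: w + y) = f (h *: v + x)) ->
  is_derive x v f l -> is_derive y w g l.
Proof.
move=> gf [df fl].
have gfE : (fun h : R => h^-1 *: ((g \o shift y) (h *: w) - g y)) =
           (fun h : R => h^-1 *: ((f \o shift x) (h *: v) - f x)).
  apply/funext => h /=; rewrite gf; congr (_ *: (_ - _)).
  by have := gf 0; rewrite !scale0r !add0r.
split; first by rewrite /derivable gfE.
by rewrite -fl /derive gfE.
Qed.

Lemma row_cons_continuous1 (R : realType) (n : nat) (x : 'rV[R]_n) :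
  continuous (fun a : R => row_cons (a, x)).
Proof.
move=> a; apply/cvg_ballP => e e0.
apply: filterS (@nbhsx_ballx _ R a e e0) => b ab.
split=> // i j; rewrite !mxE.
by case: unliftP => [k|] _ //; exact: ballxx.
Qed.

Lemma row_cons_continuous2 (R : realType) (n : nat) (a : R) :
  continuous (fun x : 'rV[R]_n => row_cons (a, x)).
Proof.
move=> x A /nbhs_ballP[e /= e0 eA]; apply/nbhs_ballP; exists e => //= y [_ xy].
apply: eA; split=> // i j; rewrite !mxE.
by case: unliftP => [k|] _ //; exact: ballxx.
Qed.

Lemma row_cons0_delta (R : realType) (n : nat) (a h : R) (x : 'rV[R]_n) :
  row_cons (h + a, x) = h *: delta_mx ord0 ord0 + row_cons (a, x) :> 'rV[R]_n.+1.
Proof.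
apply/rowP => j; rewrite !mxE eqxx/=.
by case: unliftP => [k|] -> /=; rewrite ?mulr1// mulr0 add0r.
Qed.

Lemma row_cons_lift_delta (R : realType) (n : nat) (a h : R) (x : 'rV[R]_n)
    (i : 'I_n) :
  row_cons (a, h *: delta_mx ord0 i + x) =
  h *: delta_mx ord0 (lift ord0 i) + row_cons (a, x) :> 'rV[R]_n.+1.
Proof.
apply/rowP => j; rewrite !mxE eqxx/=.
case: unliftP => [k|] -> /=; first by rewrite !mxE eqxx/= (inj_eq lift_inj).
by rewrite mulr0 add0r.
Qed.

(** The divergence theorem on the torus, one direction at a time: integrating
    first in that direction, the fundamental theorem of calculus over a period
    gives G(pi) - G(-pi) = 0. The induction on the dimension only serves to
    bring the direction to the first place. *)
Lemma integral_periodic_derive (R : realType) (n : nat) (i : 'I_n)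
    (G dG : 'rV[R]_n -> R) :
  (forall x, is_derive x (delta_mx ord0 i : 'rV[R]_n) G (dG x)) ->
  continuous dG ->
  (forall x, G (x + (2 * pi) *: delta_mx ord0 i) = G x) ->
  (\int[torus_measure n]_x (dG x)%:E = 0)%E.
Proof.
elim: n i G dG => [[]//|n IHn] i G dG GdG cdG Gper.
have idG := continuous_integrable cdG.
have irc := integrable_row_cons idG.
rewrite integral_row_cons//.
case: (unliftP ord0 i) => [k|] ik; rewrite ik in GdG Gper.
  apply: etrans; first exact/esym/(integral12_prod_meas1 irc).
  apply: integral0_eq => a _.
  apply: (IHn k (fun x => G (row_cons (a, x))) (fun x => dG (row_cons (a, x)))).
  - move=> x; apply: is_derive_line (GdG (row_cons (a, x))) => h.
    by rewrite row_cons_lift_delta.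
  - move=> x; apply: (@continuous_comp 'rV[R]_n 'rV[R]_n.+1 R
      (fun x => row_cons (a, x)) dG); last exact: cdG.
    exact: row_cons_continuous2.
  - by move=> x; rewrite addrC row_cons_lift_delta addrC Gper.
apply: etrans; first exact/esym/(integral21_prod_meas1 irc).
apply: integral0_eq => x _.
apply: etrans; first apply: (@integral_segment_derive R
  (fun a => G (row_cons (a, x))) (fun a => dG (row_cons (a, x)))).
- move=> a; apply: (@continuous_comp R 'rV[R]_n.+1 R
    (fun a => row_cons (a, x)) dG); last exact: cdG.
  exact: row_cons_continuous1.
- move=> a; apply: is_derive_line (GdG (row_cons (a, x))) => h.
  by rewrite -row_cons0_delta -[h *: 1]/(h * 1) mulr1.
- have -> : (pi, x) = (2 * pi + - pi, x) :> R * _ by congr pair; ring.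
  by rewrite row_cons0_delta [_ *: _ + _]addrC Gper subrr.
Qed.


(** * Periodic heat flows and their dissipation inequality *)

Lemma is_derive_comp_real (R : realType) (V : normedModType R) (phi : R -> R)
    (f : V -> R) (x v : V) (l l' : R) :
  is_derive (f x) 1 phi l' -> is_derive x v f l ->
  is_derive x v (phi \o f) (l' * l).
Proof.
move=> phil fl.
have gl : is_derive (0 : R) 1 (fun s : R => f (s *: v + x)) l.
  apply: is_derive_line fl => h.
  by rewrite addr0 -[h *: 1]/(h * 1) mulr1.
have : is_derive (0 : R) 1 (phi \o (fun s : R => f (s *: v + x))) (l' * l).
  by apply: is_derive1_comp => //=; rewrite scale0r add0r.
apply: is_derive_line => h /=.
by rewrite addr0 -[h *: 1]/(h * 1) mulr1.
Qed.

(** The derivatives are explicit functions rather than values of derivation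
    operators, so that linear combinations and time shifts of solutions are
    obtained by combining and shifting the derivatives as well. *)
Record smooth_flow (R : realType) (n : nat) (u ut : R -> 'rV[R]_n -> R)
    (ux uxx : 'I_n -> R -> 'rV[R]_n -> R) : Prop := SmoothFlow {
  flow_periodic : forall (t : R) (x : 'rV[R]_n) (i : 'I_n), 0 < t ->
    u t (x + (2 * pi) *: delta_mx ord0 i) = u t x;
  flow_dt : forall (t : R) (x : 'rV[R]_n), 0 < t ->
    is_derive t 1 (u^~ x) (ut t x);
  flow_dx : forall (t : R) (x : 'rV[R]_n) (i : 'I_n), 0 < t ->
    is_derive x (delta_mx ord0 i : 'rV[R]_n) (u t) (ux i t x);
  flow_dxx : forall (t : R) (x : 'rV[R]_n) (i : 'I_n), 0 < t ->
    is_derive x (delta_mx ord0 i : 'rV[R]_n) (ux i t) (uxx i t x);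
  flow_cont : forall t : R, 0 < t -> continuous (u t);
  flow_cont_x : forall (t : R) (i : 'I_n), 0 < t -> continuous (ux i t);
  flow_cont_xx : forall (t : R) (i : 'I_n), 0 < t -> continuous (uxx i t);
  flow_cont_t : forall (t : R) (x : 'rV[R]_n), 0 < t ->
    {for (t, x), continuous (fun z : R * 'rV[R]_n => ut z.1 z.2)};
  flow_heat : forall (t : R) (x : 'rV[R]_n), 0 < t ->
    ut t x = \sum_(i < n) uxx i t x
}.

Arguments flow_cont {R n u ut ux uxx} _ {t} _ _.
Arguments flow_cont_x {R n u ut ux uxx} _ {t} _ _ _.
Arguments flow_cont_xx {R n u ut ux uxx} _ {t} _ _ _.

Lemma flow_periodic_x (R : realType) (n : nat) (u ut : R -> 'rV[R]_n -> R)
    (ux uxx : 'I_n -> R -> 'rV[R]_n -> R) (t : R) (x : 'rV[R]_n) (i j : 'I_n) :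
  smooth_flow u ut ux uxx -> 0 < t ->
  ux i t (x + (2 * pi) *: delta_mx ord0 j) = ux i t x.
Proof.
move=> U t0.
have [_ <-] := flow_dx U (x + (2 * pi) *: delta_mx ord0 j) i t0.
have : is_derive (x + (2 * pi) *: delta_mx ord0 j)
    (delta_mx ord0 i : 'rV[R]_n) (u t) (ux i t x).
  apply: is_derive_line (flow_dx U x i t0) => h.
  by rewrite addrA (flow_periodic U).
by case.
Qed.

Section dissipation.
Context (R : realType) (n : nat).
Notation mu := (@torus_measure R n).
Variables (u ut : R -> 'rV[R]_n -> R) (ux uxx : 'I_n -> R -> 'rV[R]_n -> R).
Hypothesis U : smooth_flow u ut ux uxx.
Variables phi phi1 phi2 : R -> R.
Hypothesis dphi : forall y : R, is_derive y 1 phi (phi1 y).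
Hypothesis dphi1 : forall y : R, is_derive y 1 phi1 (phi2 y).
Hypothesis phi2_ge0 : forall y, 0 <= phi2 y.
Hypothesis phi2_cont : continuous phi2.

Let phi1_cont : continuous phi1 := is_derive_continuous dphi1.

Let phi_cont : continuous phi := is_derive_continuous dphi.

Let comp_cont (g : R -> R) (w : 'rV[R]_n -> R) :
  continuous g -> continuous w -> continuous (fun x => g (w x)).
Proof.
move=> cg cw x; apply: (@continuous_comp 'rV[R]_n R R w g); last exact: cg.
exact: cw.
Qed.

Let mul_cont (g w : 'rV[R]_n -> R) :
  continuous g -> continuous w -> continuous (fun x => g x * w x).
Proof. by move=> cg cw x; apply: continuousM; [exact: cg|exact: cw]. Qed.

Let add_cont (g w : 'rV[R]_n -> R) :
  continuous g -> continuous w -> continuous (fun x => g x + w x).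
Proof. by move=> cg cw x; apply: continuousD; [exact: cg|exact: cw]. Qed.

Let sum_cont (g : 'I_n -> 'rV[R]_n -> R) :
  (forall i, continuous (g i)) -> continuous (fun x => \sum_(i < n) g i x).
Proof.
move=> cg x; elim: (index_enum _) => [|i s IHs].
  by under eq_fun do rewrite big_nil; exact: cst_continuous.
under eq_fun do rewrite big_cons.
by apply: continuousD; [exact: cg|exact: IHs].
Qed.

Let dissipation_cont (t : R) :
  0 < t -> continuous (fun x => phi1 (u t x) * ut t x).
Proof.
move=> t0; apply: mul_cont; first exact: comp_cont phi1_cont (flow_cont U t0).
have -> : ut t = fun x => \sum_(i < n) uxx i t x.
  by apply/funext => x; rewrite (flow_heat U).
by apply: sum_cont => i; exact: (flow_cont_xx U).
Qed.

(** The field phi'(u) grad u has divergence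
    phi''(u) |grad u|^2 + phi'(u) Lap u, whose integral is zero, and its first
    term is nonnegative by convexity of phi. *)
Lemma dissipation_le0 (t : R) : 0 < t ->
  \int[mu]_x (phi1 (u t x) * ut t x) <= 0.
Proof.
move=> t0.
pose dG i x := phi2 (u t x) * ux i t x * ux i t x + phi1 (u t x) * uxx i t x.
have cu := flow_cont U t0.
have cdG i : continuous (dG i).
  apply: add_cont.
    apply: mul_cont; last exact: (flow_cont_x U).
    by apply: mul_cont; [exact: comp_cont phi2_cont cu|exact: (flow_cont_x U)].
  by apply: mul_cont; [exact: comp_cont phi1_cont cu|exact: (flow_cont_xx U)].
have dG0 i : (\int[mu]_x (dG i x)%:E = 0)%E.
  apply: (@integral_periodic_derive R n i (fun x => phi1 (u t x) * ux i t x)).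
  - move=> x.
    have d1 := is_derive_comp_real (dphi1 (u t x)) (flow_dx U x i t0).
    apply: (is_derive_eq (is_deriveM d1 (flow_dxx U x i t0))).
    rewrite /dG /= -![_ *: _]/(_ * _); ring.
  - exact: cdG.
  - by move=> x; rewrite (flow_periodic U)// (flow_periodic_x x i i U).
have -> : 0 = \int[mu]_x (\sum_(i < n) dG i x).
  rewrite /Rintegral; under eq_integral do rewrite -sumEFin.
  rewrite integral_sum//; last by move=> i; exact: continuous_integrable.
  by rewrite big1.
apply: le_Rintegral => //.
- by apply: continuous_integrable; exact: dissipation_cont.
- by apply: continuous_integrable; exact: sum_cont.
- move=> x _; rewrite (flow_heat U)// mulr_sumr; apply: ler_sum => i _.
  by rewrite /dG lerDr -mulrA -expr2 mulr_ge0// sqr_ge0.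
Qed.

Lemma flow_dt_bounded (a b : R) : 0 < a ->
  exists K, forall r x, r \in `[a, b] -> cube R n x -> `|ut r x| <= K.
Proof.
move=> a0.
pose A : set (R * 'rV[R]_n) := `[a, b] `*` cube R n.
have cA : compact ((fun z : R * 'rV[R]_n => ut z.1 z.2) @` A).
  apply: continuous_compact; last first.
    by apply: compact_setX; [exact: segment_compact|exact: compact_cube].
  apply: continuous_in_subspaceT => -[r x]; rewrite inE => -[/= rab _].
  apply: (flow_cont_t U); move: rab; rewrite /= in_itv/= => /andP[+ _].
  exact: lt_le_trans.
have [K [Kr /(_ (K + 1))]] := compact_bounded cA.
rewrite ltrDl ltr01 => /(_ isT) AK; exists (K + 1) => r x rab Qx.
by apply: AK; exists (r, x).
Qed.

Variable L : R.
Hypothesis phi1_bound : forall y, `|phi1 y| <= L.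

(** The integrand of [dissipation_le0] is the time derivative of phi(u). The
    derivation under the integral sign is justified on the compact cube, where
    phi'(u) u_t is bounded uniformly for times in a compact interval. *)
Lemma entropy_nonincreasing (s t : R) : 0 < s -> s <= t ->
  \int[mu]_x phi (u t x) <= \int[mu]_x phi (u s x).
Proof.
move=> s0 st.
pose F r := \int[mu]_(x in cube R n) phi (u r x).
have t0 : 0 < t by exact: lt_le_trans st.
have iphi (r : R) : 0 < r -> mu.-integrable setT (fun x => (phi (u r x))%:E).
  move=> r0; apply: continuous_integrable.
  exact: comp_cont phi_cont (flow_cont U r0).
have FE (r : R) : 0 < r -> F r = \int[mu]_x phi (u r x).
  by move=> r0; rewrite /F /Rintegral integral_cube//; exact: iphi.
have [K utK] := @flow_dt_bounded (s / 2) (2 * t) (divr_gt0 s0 (ltr0n _ 2)).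
have mQ := @measurable_cube R n.
have I0 r : r \in `]s / 2, 2 * t[ -> 0 < r.
  by rewrite in_itv/= => /andP[sr _]; rewrite (lt_trans _ sr)// divr_gt0.
have iQ r : r \in `]s / 2, 2 * t[ ->
    mu.-integrable (cube R n) (EFin \o (phi \o u r)).
  by move=> /I0 r0; apply: integrableS (iphi r r0).
have dphiu (r : R) x : 0 < r ->
    is_derive r 1 (fun r => phi (u r x)) (phi1 (u r x) * ut r x).
  by move=> r0; apply: is_derive_comp_real (dphi (u r x)) (flow_dt U x r0).
have d1E (r : R) x : 0 < r ->
    partial1of2 (fun r x => phi (u r x)) r x = phi1 (u r x) * ut r x.
  by move=> r0; rewrite partial1of2E; have [] := dphiu r x r0.
have d1phi (r : R) x : r \in `]s / 2, 2 * t[ -> cube R n x ->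
    derivable (fun r => phi (u r x)) r 1.
  by move=> /I0 r0 _; have [] := dphiu r x r0.
have d1K (r : R) x : r \in `]s / 2, 2 * t[ -> cube R n x ->
    `|partial1of2 (fun r x => phi (u r x)) r x| <= `|L * K|.
  move=> rI Qx; rewrite d1E ?I0// [leRHS]ger0_norm.
    rewrite normrM ler_pM// utK//.
    exact: subset_itv_oo_cc rI.
  rewrite mulr_ge0 ?(le_trans _ (phi1_bound 0))//.
  rewrite (le_trans _ (utK _ _ (subset_itv_oo_cc rI) Qx))//.
have iK : mu.-integrable (cube R n) (EFin \o (fun=> `|L * K|)).
  apply: (@integrableS _ _ _ _ setT) => //.
  exact: finite_measure_integrable_cst.
have derF r : r \in `]s / 2, 2 * t[ -> derivable F r 1.
  move=> rI.
  exact: (@derivable_under_integral _ _ _ mu (fun r x => phi (u r x)) _ mQ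
    r (s / 2) (2 * t) rI iQ d1phi (fun=> `|L * K|) (fun=> normr_ge0 _) iK d1K).
have F'le0 r : r \in `]s / 2, 2 * t[ -> derive1 F r <= 0.
  move=> rI.
  have -> : derive1 F r = _ := (@differentiation_under_integral _ _ _ mu
    (fun r x => phi (u r x)) _ mQ r (s / 2) (2 * t) rI iQ d1phi (fun=> `|L * K|) (fun=> normr_ge0 _) iK d1K).
  under eq_Rintegral => x _ do rewrite d1E ?I0//.
  rewrite /Rintegral integral_cube; first exact: dissipation_le0 (I0 _ rI).
  by apply: continuous_integrable; exact: dissipation_cont (I0 _ rI).
rewrite -FE// -FE//.
have sub r : r \in `[s, t] -> r \in `]s / 2, 2 * t[.
  rewrite !in_itv/= => /andP[sr rt]; apply/andP; split; lra.
apply: (@ler0_derive1_le_cc R F s t) => //.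
- by move=> r /subset_itv_oo_cc/sub; exact: derF.
- by move=> r /subset_itv_oo_cc/sub; exact: F'le0.
- by apply: derivable_within_continuous => r /sub; exact: derF.
- by rewrite in_itv/= lexx st.
- by rewrite in_itv/= lexx st.
Qed.

End dissipation.


(** * Balls of L^p *)

(** Bounds by a real number keep the estimates of the splitting operator out
    of the extended reals. *)
Definition Lp_ball (R : realType) (n : nat) (p : \bar R) (r : R) :
    set ('rV[R]_n -> R) :=
  [set g | g \in Lfun (torus_measure n) p /\ (Lp_norm p g <= r%:E)%E].

Section Lp_ball.
Context (R : realType) (n : nat) (p : \bar R) (p1 : (1 <= p)%E).
Implicit Types (f g : 'rV[R]_n -> R) (a b r : R).
Notation mu := (@torus_measure R n).

Lemma Lp_ballP r f :
  Lp_ball p r f <-> measurable_fun setT f /\ (Lp_norm p f <= r%:E)%E.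
Proof.
split=> [[/andP[/[!inE]/= mf _]]//|[mf fr]]; split=> //.
apply/andP; split; rewrite inE//=.
by rewrite /finite_norm (le_lt_trans fr)// ltry.
Qed.

Lemma Lfun_Lp_ball f : f \in Lfun mu p -> Lp_ball p (fine (Lp_norm p f)) f.
Proof.
move=> fp; split => //; rewrite fineK// ge0_fin_numE ?Lnorm_ge0//.
by move: fp => /andP[_ /[!inE]].
Qed.

Lemma Lp_ball_ge0 r f : Lp_ball p r f -> 0 <= r.
Proof. by case=> _; rewrite -lee_fin; apply: le_trans; exact: Lnorm_ge0. Qed.

Lemma Lp_ball_le r r' f : r <= r' -> Lp_ball p r f -> Lp_ball p r' f.
Proof. by move=> rr' [fp fr]; split=> //; rewrite (le_trans fr)// lee_fin. Qed.

Lemma Lp_ballD a b f g :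
  Lp_ball p a f -> Lp_ball p b g -> Lp_ball p (a + b) (fun x => f x + g x).
Proof.
move=> /Lp_ballP[mf fa] /Lp_ballP[mg gb]; apply/Lp_ballP; split.
  exact: measurable_funD.
by rewrite (le_trans (eminkowski _ mf mg p1))// EFinD leeD.
Qed.

Lemma Lp_ball_norm_le r f g : measurable_fun setT g ->
  {ae mu, forall x, `|g x| <= `|f x|} -> Lp_ball p r f -> Lp_ball p r g.
Proof.
move=> mg gf /Lp_ballP[mf fr]; apply/Lp_ballP; split=> //.
apply: le_trans fr; rewrite /Lp_norm.
have mn (h : 'rV[R]_n -> R) q : measurable_fun setT h ->
    measurable_fun setT (fun x => ((`|h x| `^ q)%:E)).
  move=> mh; apply/measurable_EFinP.
  apply: (@measurableT_comp _ _ _ _ _ _ (@powR R ^~ q)) => //.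
  exact: measurableT_comp.
case: p p1 => [q| |//]; rewrite unlock /= => q1.
- rewrite lee_fin in q1.
  apply: gt0_ler_poweR => //.
  + by rewrite invr_ge0 (le_trans _ q1).
  + rewrite in_itv/= leey andbT; apply: integral_ge0 => x _.
    by rewrite lee_fin powR_ge0.
  + rewrite in_itv/= leey andbT; apply: integral_ge0 => x _.
    by rewrite lee_fin powR_ge0.
  apply: ae_ge0_le_integral => //.
  + exact: mn.
  + exact: mn.
  + apply: filterS gf => x gfx _; rewrite lee_fin.
    by rewrite ge0_ler_powR ?nnegrE// (le_trans _ q1).
- case: ifPn => // _; apply: le_ess_sup.
  by apply: filterS gf => x gfx; rewrite /= lee_fin.
Qed.

Lemma Lp_ballZ c r f : Lp_ball p r f -> Lp_ball p (`|c| * r) (fun x => c * f x).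
Proof.
move=> [fp fr]; apply/Lp_ballP; split.
  move: fp => /andP[/[!inE]/= mf _].
  exact: measurable_funM.
have := @LnormZ _ _ _ mu p p1 (Lfun_Sub p1 fp) c.
rewrite /Lp_norm => ->.
by rewrite EFinM lee_wpmul2l.
Qed.

Lemma Lp_ballB a b f g :
  Lp_ball p a f -> Lp_ball p b g -> Lp_ball p (a + b) (fun x => f x - g x).
Proof.
move=> fa /(Lp_ballZ (-1)); rewrite normrN1 mul1r => gb.
have := Lp_ballD fa gb.
by under eq_fun do rewrite mulN1r.
Qed.

Lemma volume_root_ge0 : 0 <= volume_root n p.
Proof. by rewrite /volume_root; case: p => // q; exact: powR_ge0. Qed.

Lemma Lp_ball_cst c : @Lp_ball R n p (`|c| * volume_root n p) (fun=> c).
Proof.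
suff : @Lp_ball R n p (volume_root n p) (fun=> 1 : R).
  by move=> /(Lp_ballZ c); under eq_fun do rewrite mulr1.
apply/Lp_ballP; split; first exact: measurable_cst.
rewrite /Lp_norm /volume_root; case: p p1 => [q q1| _|//].
- rewrite [X in Lnorm _ _ X](_ : _ = cst 1%E)// Lnorm_cst1.
  by rewrite -[X in (X `^ _ <= _)%E]fineK ?fin_num_measure// poweR_EFin.
- rewrite unlock torus_measure_gt0; apply/ess_supP.
  by apply: nearW => x /=; rewrite normr1.
Qed.

Lemma Lp_ball_sum (I : Type) (s : seq I) (r : I -> R) (f : I -> 'rV[R]_n -> R) :
  (forall i, Lp_ball p (r i) (f i)) ->
  Lp_ball p (\sum_(i <- s) r i) (fun x => \sum_(i <- s) f i x).
Proof.
move=> fr; elim: s => [|i s IHs].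
  have -> : (fun x => \sum_(i <- [::]) f i x) = fun=> 0.
    by apply/funext => x; rewrite big_nil.
  by rewrite big_nil; have := Lp_ball_cst 0; rewrite normr0 mul0r.
have -> : (fun x => \sum_(j <- i :: s) f j x) =
    fun x => f i x + \sum_(j <- s) f j x.
  by apply/funext => x; rewrite big_cons.
by rewrite big_cons; exact: Lp_ballD.
Qed.

Lemma Lp_ball_Lfun1 r f : Lp_ball p r f -> f \in Lfun mu 1.
Proof.
move=> [fp _]; apply: Lfun_subset fp; rewrite ?fin_num_measure// lexx.
Qed.

End Lp_ball.

Lemma Lp_ball1P (R : realType) (n : nat) (r : R) (f : 'rV[R]_n -> R) :
  Lp_ball 1 r f <-> (torus_measure n).-integrable setT (EFin \o f) /\
    \int[torus_measure n]_x `|f x| <= r.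
Proof.
have fE : (torus_measure n).-integrable setT (EFin \o f) ->
    Lp_norm 1 f = (\int[torus_measure n]_x `|f x|)%:E.
  move=> /integrableP[mf fi]; rewrite /Lp_norm Lnorm1 /Rintegral fineK//.
  by rewrite ge0_fin_numE// integral_ge0.
split=> [[/Lfun1_integrable fi]|[fi fr]]; first by rewrite fE.
by split; [exact/Lfun1_integrable|rewrite fE].
Qed.


(** * Heat flows with integrable initial value *)

Lemma le_increment_derive (R : realType) (g g1 : R -> R) (L a b : R) : a <= b ->
  (forall y : R, a <= y <= b -> is_derive y 1 g (g1 y)) ->
  (forall y, a <= y <= b -> `|g1 y| <= L) ->
  `|g b - g a| <= L * (b - a).
Proof.
move=> ab dg g1L.
have [y|y|c cab ->] := @MVT_segment R g g1 _ _ ab.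
- by move=> /subset_itv_oo_cc; rewrite in_itv/=; exact: dg.
- move: y; apply: derivable_within_continuous => y; rewrite in_itv/= => yab.
  by have [] := dg y yab.
- move: cab; rewrite in_itv/= => cab.
  by rewrite normrM ler_pM// ?g1L// ger0_norm// subr_ge0.
Qed.

Lemma lipschitz_derive (R : realType) (g g1 : R -> R) (L : R) :
  (forall y : R, is_derive y 1 g (g1 y)) -> (forall y, `|g1 y| <= L) ->
  forall a b, `|g a - g b| <= L * `|a - b|.
Proof.
move=> dg g1L a b; wlog ba : a b / b <= a => [H|].
  by have [/H//|/ltW/H] := leP b a; rewrite distrC (distrC b).
by rewrite [in leRHS]ger0_norm ?subr_ge0//; exact: le_increment_derive.
Qed.

Definition attains_L1 (R : realType) (n : nat) (u : R -> 'rV[R]_n -> R)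
    (v : 'rV[R]_n -> R) : Prop :=
  forall e : R, 0 < e -> exists2 del : R, 0 < del &
    forall t : R, 0 < t < del -> Lp_ball 1 e (fun x => u t x - v x).

(** Solutions without reference to a semigroup: differences and time shifts
    of values of E_A are not values of E_A a priori, but they are heat flows. *)
Record heat_flow (R : realType) (n : nat) (v : 'rV[R]_n -> R)
    (u : R -> 'rV[R]_n -> R) : Prop := HeatFlow {
  heat_flow_L1 : v \in Lfun (torus_measure n) 1;
  heat_flow0 : u 0 = v;
  heat_flow_attains : attains_L1 u v;
  heat_flow_smooth : exists ut ux uxx, smooth_flow u ut ux uxx
}.

Lemma heat_flow_continuous (R : realType) (n : nat) (v : 'rV[R]_n -> R)
    (u : R -> 'rV[R]_n -> R) (t : R) :
  heat_flow v u -> 0 < t -> continuous (u t).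
Proof. by case=> _ _ _ [ut [ux [uxx U]]]; exact: (flow_cont U). Qed.

Lemma heat_flow_measurable (R : realType) (n : nat) (v : 'rV[R]_n -> R)
    (u : R -> 'rV[R]_n -> R) (t : R) :
  heat_flow v u -> 0 <= t -> measurable_fun setT (u t).
Proof.
move=> uv; rewrite le_eqVlt => /predU1P[<-|t0].
  by rewrite (heat_flow0 uv); have /andP[/[!inE]] := heat_flow_L1 uv.
apply: continuous_measurable_row; exact: heat_flow_continuous uv t0.
Qed.

Lemma heat_flow_integrable (R : realType) (n : nat) (v : 'rV[R]_n -> R)
    (u : R -> 'rV[R]_n -> R) (t : R) :
  heat_flow v u -> 0 <= t -> (torus_measure n).-integrable setT (EFin \o u t).
Proof.
move=> uv; rewrite le_eqVlt => /predU1P[<-|t0].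
  by rewrite (heat_flow0 uv); exact/Lfun1_integrable/(heat_flow_L1 uv).
apply: continuous_integrable; exact: heat_flow_continuous uv t0.
Qed.

Lemma continuous_slice (R : realType) (n : nat) (F : R * 'rV[R]_n -> R)
    (t : R) (x : 'rV[R]_n) :
  {for (t, x), continuous F} -> {for x, continuous (fun y => F (t, y))}.
Proof.
move=> cF A /cF /nbhs_ballP[e /= e0 eA]; apply/nbhs_ballP; exists e => //= y xy.
by apply: eA; split => //=; exact: ballxx.
Qed.

Lemma heat_solution_flow (R : realType) (n : nat) (v : 'rV[R]_n -> R)
    (u : R -> 'rV[R]_n -> R) :
  v \in Lfun (torus_measure n) 1 -> heat_solution v u -> heat_flow v u.
Proof.
move=> v1 [u0 uper uC uheat ucvg].
have cu (t : R) : 0 < t -> continuous (u t).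
  by move=> t0 x; have [_ [c _ _ _]] := uC t x t0; exact: continuous_slice c.
split=> //.
- move=> e e0; move/fine_cvgP : ucvg => [ufin /cvgr_lt/(_ e e0)] une.
  have [del /= del0 H] : \forall t \near 0^'+,
      Lp_norm 1 (u t \- v) \is a fin_num /\ fine (Lp_norm 1 (u t \- v)) < e.
    by near=> t; split; near: t.
  exists del => // t /andP[t0 tdel].
  have [|//|fin lte] := H t; first by rewrite /= sub0r normrN gtr0_norm.
  apply/Lp_ballP; split.
    apply: measurable_funB; first by apply: continuous_measurable_row; exact: cu.
    by have /andP[/[!inE]] := v1.
  by rewrite -[leLHS]fineK// lee_fin ltW.
- exists (fun t x => derive1 (u^~ x) t), (fun i t => pderiv i (u t)),
    (fun i t => pderiv i (pderiv i (u t))); split => //.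
  + by move=> t x i t0; exact: uper.
  + move=> t x t0; have [[dt _ _] _] := uC t x t0.
    by split=> //; rewrite derive1E.
  + by move=> t x i t0; have [[_ dx _] _] := uC t x t0; split=> //; exact: dx.
  + by move=> t x i t0; have [[_ _ dxx] _] := uC t x t0; split=> //; exact: dxx.
  + move=> t i t0 x; have [_ [_ _ c _]] := uC t x t0.
    exact: continuous_slice (c i).
  + move=> t i t0 x; have [_ [_ _ _ c]] := uC t x t0.
    exact: continuous_slice (c i i).
  + by move=> t x t0; have [_ [_ c _ _]] := uC t x t0.
Unshelve. all: by end_near. Qed.


Lemma integrable_add (R : realType) (n : nat) (f g : 'rV[R]_n -> R) :
  (torus_measure n).-integrable setT (EFin \o f) ->
  (torus_measure n).-integrable setT (EFin \o g) ->
  (torus_measure n).-integrable setT (EFin \o (fun x => f x + g x)).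
Proof. by move=> fi gi; have := integrableD measurableT fi gi. Qed.

Lemma integrable_scale (R : realType) (n : nat) (c : R) (f : 'rV[R]_n -> R) :
  (torus_measure n).-integrable setT (EFin \o f) ->
  (torus_measure n).-integrable setT (EFin \o (fun x => c * f x)).
Proof. by move=> fi; have := integrableZl measurableT c fi. Qed.

Lemma integrable_comp_lipschitz (R : realType) (n : nat) (phi : R -> R) (L : R)
    (w : 'rV[R]_n -> R) :
  (forall a b, `|phi a - phi b| <= L * `|a - b|) ->
  (torus_measure n).-integrable setT (EFin \o w) ->
  (torus_measure n).-integrable setT (EFin \o (phi \o w)).
Proof.
move=> philip iw; have /measurable_EFinP mw := measurable_int _ iw.
have L0 : 0 <= L.
  by have := philip 1 0; rewrite subr0 normr1 mulr1; exact: le_trans.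
have mphi : measurable_fun setT phi.
  apply: continuous_measurable_fun => y; apply/cvgrPdist_lt => e e0.
  near=> z; rewrite (le_lt_trans (philip _ _))//.
  rewrite (@le_lt_trans _ _ ((L + 1) * `|y - z|))//.
    by rewrite ler_wpM2r// lerDl.
  rewrite mulrC -ltr_pdivlMr ?ltr_wpDl//; near: z.
  by apply: cvgr_dist_lt => //; rewrite divr_gt0 ?ltr_wpDl.
have ib : (torus_measure n).-integrable setT
    (EFin \o (fun x => `|phi 0| + L * `|w x|)).
  apply: integrable_add; first exact: finite_measure_integrable_cst.
  by apply: integrable_scale; exact: integrable_norm.
apply: le_integrable ib => //.
  by apply/measurable_EFinP; exact: measurableT_comp.
move=> x _; rewrite /= lee_fin [leRHS]ger0_norm ?addr_ge0 ?mulr_ge0//.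
have := philip (w x) 0; rewrite subr0.
move: (ler_normD (phi (w x) - phi 0) (phi 0)); rewrite subrK => h1 h2.
by rewrite (le_trans h1)// addrC lerD2l.
Unshelve. all: by end_near. Qed.

(** A Lipschitz phi makes the integral of phi(w) continuous in w for the L^1
    norm, so that the inequality between two positive times passes to the
    limit as the earlier one tends to 0. *)
Lemma entropy_le_initial (R : realType) (n : nat) (v : 'rV[R]_n -> R)
    (u : R -> 'rV[R]_n -> R) (phi phi1 phi2 : R -> R) (L t : R) :
  heat_flow v u ->
  (forall y : R, is_derive y 1 phi (phi1 y)) ->
  (forall y : R, is_derive y 1 phi1 (phi2 y)) ->
  (forall y, 0 <= phi2 y) -> continuous phi2 -> (forall y, `|phi1 y| <= L) ->
  0 < t ->
  \int[torus_measure n]_x phi (u t x) <= \int[torus_measure n]_x phi (v x).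
Proof.
move=> uv dphi dphi1 phi2_ge0 phi2_cont phi1_le t0.
have L0 : 0 <= L by apply: le_trans (phi1_le 0).
have philip := lipschitz_derive dphi phi1_le.
have iphi (w : 'rV[R]_n -> R) : (torus_measure n).-integrable setT (EFin \o w) ->
    (torus_measure n).-integrable setT (EFin \o (phi \o w)).
  exact: integrable_comp_lipschitz.
have iv : (torus_measure n).-integrable setT (EFin \o v).
  by rewrite -(heat_flow0 uv); apply: heat_flow_integrable uv _.
apply/ler_addgt0Pr => e e0.
have [del del0 H] := heat_flow_attains uv (divr_gt0 e0 (ltr_wpDl L0 ltr01)).
pose s := Num.min t (del / 2).
have s0 : 0 < s by rewrite lt_min t0 divr_gt0.
have [ut [ux [uxx U]]] := heat_flow_smooth uv.
have st : s <= t by rewrite ge_min lexx.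
have := entropy_nonincreasing U dphi dphi1 phi2_ge0 phi2_cont phi1_le s0 st.
move=> /le_trans; apply.
have /Lp_ball1P[id1 dle] : Lp_ball 1 (e / (L + 1)) (fun x => u s x - v x).
  apply: H; rewrite s0 (le_lt_trans (y := del / 2))//.
    by rewrite /s ge_min lexx orbT.
  by rewrite ltr_pdivrMr// ltr_pMr// ltr1n.
have iu := heat_flow_integrable uv (ltW s0).
apply: (@le_trans _ _
  (\int[torus_measure n]_x (phi (v x) + L * `|u s x - v x|))).
  apply: le_Rintegral => //; first exact: iphi.
  - apply: integrable_add; first exact: iphi.
    by apply: integrable_scale; exact: integrable_norm id1.
  - move=> x _; rewrite -lerBlDl (le_trans (ler_norm _))//; exact: philip.
rewrite RintegralD//; last 2 first.
- exact: iphi.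
- by apply: integrable_scale; exact: integrable_norm id1.
rewrite lerD2l RintegralZl//; last exact: integrable_norm id1.
rewrite (le_trans (ler_wpM2l L0 dle))//.
rewrite mulrCA; apply: ler_piMr; first exact: ltW.
by rewrite ler_pdivrMr ?mul1r ?lerDl ?ltr_wpDl.
Qed.

Lemma heat_flow_mass_le (R : realType) (n : nat) (v : 'rV[R]_n -> R)
    (u : R -> 'rV[R]_n -> R) (t : R) :
  heat_flow v u -> 0 <= t ->
  \int[torus_measure n]_x u t x <= \int[torus_measure n]_x v x.
Proof.
move=> uv; rewrite le_eqVlt => /predU1P[<-|t0].
  by rewrite (heat_flow0 uv).
apply: (@entropy_le_initial R n v u id (fun=> 1) (fun=> 0) 1 t uv) => //.
- by move=> y; exact: cst_continuous.
- by move=> y; rewrite normr1.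
Qed.

Section smooth_abs.
Context (R : realType) (e : R) (e0 : 0 < e).

Let s (y : R) := Num.sqrt (e + y ^+ 2).

Let s_gt0 y : 0 < s y.
Proof. by rewrite sqrtr_gt0 ltr_wpDr// sqr_ge0. Qed.

Let s2 y : s y ^+ 2 = e + y ^+ 2.
Proof. by rewrite sqr_sqrtr// addr_ge0 ?sqr_ge0// ltW. Qed.

Lemma is_derive_smooth_abs (y : R) :
  is_derive y 1 (fun y => Num.sqrt (e + y ^+ 2)) (y / Num.sqrt (e + y ^+ 2)).
Proof.
have d2 : is_derive y 1 (fun y => e + y ^+ 2) (2 * y).
  have -> : (fun y => e + y ^+ 2) = cst e + (@id R) * (@id R).
    by apply/funext => z; rewrite !fctE expr2.
  apply: (is_derive_eq (is_deriveD (is_derive_cst e y 1)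
    (is_deriveM (is_derive_id y 1) (is_derive_id y 1)))).
  rewrite -![_ *: _]/(_ * _); ring.
have p0 : 0 < e + y ^+ 2 by rewrite ltr_wpDr// sqr_ge0.
have ds := @is_derive1_comp R Num.sqrt (fun y => e + y ^+ 2) y _ _
  (is_derive1_sqrt p0) d2.
apply: (is_derive_eq ds).
by rewrite -/(s y); have := s_gt0 y => sy; field; rewrite gt_eqF.
Qed.

Lemma is_derive_smooth_sign (y : R) :
  is_derive y 1 (fun y => y / Num.sqrt (e + y ^+ 2))
    (e / Num.sqrt (e + y ^+ 2) ^+ 3).
Proof.
have sy := s_gt0 y.
have dV := is_deriveV (lt0r_neq0 sy) (is_derive_smooth_abs y).
have dM := is_deriveM (is_derive_id y 1) dV.
apply: (is_derive_eq dM).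
rewrite -!/(s y) -![_ *: _]/(_ * _).
have -> : e = s y ^+ 2 - y ^+ 2 by rewrite s2 addrK.
by field; rewrite gt_eqF.
Qed.

Lemma smooth_abs_ge (y : R) : `|y| <= Num.sqrt (e + y ^+ 2).
Proof. by rewrite -sqrtr_sqr ler_wsqrtr// lerDr ltW. Qed.

Lemma smooth_sign_le1 (y : R) : `|y / Num.sqrt (e + y ^+ 2)| <= 1.
Proof.
rewrite normrM normfV [X in _ / X]gtr0_norm ?s_gt0//.
by rewrite ler_pdivrMr ?s_gt0// mul1r smooth_abs_ge.
Qed.

Lemma smooth_curvature_ge0 (y : R) : 0 <= e / Num.sqrt (e + y ^+ 2) ^+ 3.
Proof. by rewrite divr_ge0 ?exprn_ge0 ?sqrtr_ge0// ltW. Qed.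

Lemma smooth_curvature_continuous :
  continuous (fun y : R => e / Num.sqrt (e + y ^+ 2) ^+ 3).
Proof.
have cs : continuous s := is_derive_continuous is_derive_smooth_abs.
move=> y; apply: cvgM; first exact: cvg_cst.
apply: cvgV; first by rewrite expf_neq0// gt_eqF// s_gt0.
apply: (@continuous_comp R R R s (fun z => z ^+ 3)); first exact: cs.
exact: exprn_continuous.
Qed.

End smooth_abs.


(** The convex function sqrt(e^2 + y^2) - y has bounded derivative, lies above
    |y| - y, twice the negative part, and exceeds it by at most e. *)
Lemma heat_flow_ge0 (R : realType) (n : nat) (v : 'rV[R]_n -> R)
    (u : R -> 'rV[R]_n -> R) (t : R) :
  heat_flow v u -> {ae torus_measure n, forall x, 0 <= v x} -> 0 <= t ->
  {ae torus_measure n, forall x, 0 <= u t x}.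
Proof.
move=> uv v0; rewrite le_eqVlt => /predU1P[<-|t0].
  by rewrite (heat_flow0 uv).
have t0' := ltW t0.
have iv : (torus_measure n).-integrable setT (EFin \o v).
  exact/Lfun1_integrable/(heat_flow_L1 uv).
have iu := heat_flow_integrable uv t0'.
have ipart (w : 'rV[R]_n -> R) :
    (torus_measure n).-integrable setT (EFin \o w) ->
    (torus_measure n).-integrable setT (EFin \o (fun x => `|w x| - w x)).
  move=> iw.
  have := integrable_add (integrable_norm iw) (integrable_scale (-1) iw).
  by under [X in _.-integrable _ (_ \o X) -> _]eq_fun do rewrite /= mulN1r.
have vpart0 : \int[torus_measure n]_x (`|v x| - v x) = 0.
  rewrite /Rintegral (ae_eq_integral (cst 0%E))//.
  - by rewrite integral0.
  - by have /measurable_int := ipart v iv.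
  - by apply: filterS v0 => x vx _; rewrite /= ger0_norm// subrr.
pose V := fine (torus_measure n [set: 'rV[R]_n]).
have V0 : 0 <= V by rewrite fine_ge0.
have upart_le (e : R) : 0 < e ->
    \int[torus_measure n]_x (`|u t x| - u t x) <= e * V.
  move=> e0; have e20 : 0 < e ^+ 2 by rewrite exprn_gt0.
  pose s y := Num.sqrt (e ^+ 2 + y ^+ 2).
  have s_le y : s y <= e + `|y|.
    rewrite -(ler_pXn2r (_ : 0 < 2)%N)// ?nnegrE ?sqrtr_ge0 ?addr_ge0 ?(ltW e0)//.
    rewrite sqr_sqrtr ?addr_ge0 ?sqr_ge0// sqrrD real_normK ?num_real// lerD2r.
    by rewrite lerDl mulrn_wge0// mulr_ge0// ltW.
  have ds y := is_deriveB (is_derive_smooth_abs e20 y) (is_derive_id y (1 : R)).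
  have ds1 y := is_deriveB (is_derive_smooth_sign e20 y)
    (is_derive_cst (1 : R) y (1 : R)).
  have s1_le y : `|(y / s y) - 1| <= 2.
    rewrite (le_trans (ler_normB _ _))// normr1.
    by have := smooth_sign_le1 e20 y; rewrite -/(s y); lra.
  have s2_ge0 y : 0 <= e ^+ 2 / s y ^+ 3 - 0.
    by rewrite subr0; exact: smooth_curvature_ge0.
  have s2_cont : continuous (fun y => e ^+ 2 / s y ^+ 3 - 0).
    under eq_fun do rewrite subr0.
    exact: smooth_curvature_continuous.
  have := entropy_le_initial uv ds ds1 s2_ge0 s2_cont s1_le t0.
  rewrite /= => h.
  apply: le_trans (le_trans h _).
    apply: le_Rintegral => //.
    - exact: ipart.
    - exact: (integrable_comp_lipschitz (lipschitz_derive ds s1_le) iu).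
    - by move=> x _; rewrite lerD2r; exact: smooth_abs_ge.
  rewrite -[leRHS]addr0 -vpart0 -Rintegral_cst// -RintegralD//; last 2 first.
  - exact: finite_measure_integrable_cst.
  - exact: ipart.
  apply: le_Rintegral => //.
  - exact: (integrable_comp_lipschitz (lipschitz_derive ds s1_le) iv).
  - apply: integrable_add; last exact: ipart.
    exact: finite_measure_integrable_cst.
  - by move=> x _; rewrite addrA lerD2r s_le.
have upart0 : \int[torus_measure n]_x (`|u t x| - u t x) = 0.
  apply/eqP; rewrite eq_le Rintegral_ge0 ?andbT//; last first.
    by move=> x _; rewrite subr_ge0 ler_norm.
  apply/ler_addgt0Pr => e e0; rewrite add0r.
  apply: le_trans (upart_le (e / (V + 1)) _) _; first by rewrite divr_gt0 ?ltr_wpDl.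
  by rewrite -mulrA ler_piMr ?(ltW e0)// mulrC ler_pdivrMr ?mul1r ?lerDl ?ltr_wpDl.
have mpart := measurable_int _ (ipart _ iu).
have : (\int[torus_measure n]_x `|(`|u t x| - u t x)%:E| = 0)%E.
  under eq_integral => x _ do rewrite /= ger0_norm ?subr_ge0 ?ler_norm//.
  rewrite -[LHS]fineK ?(integrable_fin_num _ (ipart _ iu))//.
  by rewrite -[fine _]/(Rintegral _ _ _) upart0.
move=> /(ae_eq_integral_abs _ measurableT mpart).
apply: filterS => x /(_ I) /= /eqP; rewrite eqe subr_eq0 => /eqP <-.
exact: normr_ge0.
Qed.

Lemma is_derive_affine (R : realType) (V : normedModType R) (f g : V -> R)
    (x v : V) (a b c l l' : R) :
  is_derive x v f l -> is_derive x v g l' ->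
  is_derive x v (fun y => a * f y + b * g y + c) (a * l + b * l').
Proof.
move=> fl gl.
have H := is_deriveD (is_deriveD (is_deriveZ a fl) (is_deriveZ b gl))
  (is_derive_cst c x v).
apply: (is_derive_eq H).
by rewrite addr0.
Qed.

Lemma continuous_affine (R : realType) (T : topologicalType) (f g : T -> R)
    (x : T) (a b c : R) :
  {for x, continuous f} -> {for x, continuous g} ->
  {for x, continuous (fun y => a * f y + b * g y + c)}.
Proof.
move=> cf cg; apply: cvgD; last exact: cvg_cst.
by apply: cvgD; apply: cvgM => //; exact: cvg_cst.
Qed.

Lemma heat_flow_affine (R : realType) (n : nat) (v1 v2 : 'rV[R]_n -> R)
    (u1 u2 : R -> 'rV[R]_n -> R) (a b c : R) :
  heat_flow v1 u1 -> heat_flow v2 u2 ->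
  heat_flow (fun x => a * v1 x + b * v2 x + c)
    (fun t x => a * u1 t x + b * u2 t x + c).
Proof.
case=> v1L u10 u1a [u1t [u1x [u1xx U1]]] [v2L u20 u2a [u2t [u2x [u2xx U2]]]].
split.
- move: v1L v2L => /Lfun1_integrable v1i /Lfun1_integrable v2i.
  apply/Lfun1_integrable; apply: integrable_add.
    by apply: integrable_add; exact: integrable_scale.
  exact: finite_measure_integrable_cst.
- by rewrite u10 u20.
- move=> e e0.
  have pos (z : R) : 0 < 2 * (`|z| + 1) by rewrite mulr_gt0// ltr_wpDl.
  have half (z : R) : `|z| * (e / (2 * (`|z| + 1))) <= e / 2.
    rewrite mulrCA ler_pM2l// ler_pdivrMr//.
    by rewrite mulrA mulVf// mul1r lerDl.
  have [d1 d10 H1] := u1a _ (divr_gt0 e0 (pos a)).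
  have [d2 d20 H2] := u2a _ (divr_gt0 e0 (pos b)).
  exists (Num.min d1 d2); first by rewrite lt_min d10.
  move=> t /andP[t0]; rewrite lt_min => /andP[td1 td2].
  have B1 := Lp_ballZ (lexx _) a (H1 t (introT andP (conj t0 td1))).
  have B2 := Lp_ballZ (lexx _) b (H2 t (introT andP (conj t0 td2))).
  have := Lp_ballD (lexx _) B1 B2.
  move=> /(Lp_ball_le (_ : _ <= e)) H.
  rewrite (_ : (fun x => _) =
      (fun x => a * (u1 t x - v1 x) + b * (u2 t x - v2 x))).
    apply: H; rewrite (le_trans (lerD (half a) (half b)))//.
    by rewrite -splitr.
  by apply/funext => x; ring.
- exists (fun t x => a * u1t t x + b * u2t t x),
    (fun i t x => a * u1x i t x + b * u2x i t x),
    (fun i t x => a * u1xx i t x + b * u2xx i t x).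
  have drop0 (f g : R -> 'rV[R]_n -> R) t :
      (fun x => a * f t x + b * g t x) = (fun x => a * f t x + b * g t x + 0).
    by apply/funext => x; rewrite addr0.
  split.
  + by move=> t x i t0; rewrite (flow_periodic U1)// (flow_periodic U2).
  + by move=> t x t0; exact: is_derive_affine (flow_dt U1 x t0) (flow_dt U2 x t0).
  + move=> t x i t0.
    exact: is_derive_affine (flow_dx U1 x i t0) (flow_dx U2 x i t0).
  + move=> t x i t0; rewrite (drop0 (u1x i) (u2x i)).
    exact: is_derive_affine (flow_dxx U1 x i t0) (flow_dxx U2 x i t0).
  + move=> t t0 x; exact: (@continuous_affine R 'rV[R]_n _ _ x a b c
      (flow_cont U1 t0 x) (flow_cont U2 t0 x)).
  + move=> t i t0 x; rewrite (drop0 (u1x i) (u2x i)).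
    exact: (@continuous_affine R 'rV[R]_n _ _ x a b 0
      (flow_cont_x U1 i t0 x) (flow_cont_x U2 i t0 x)).
  + move=> t i t0 x; rewrite (drop0 (u1xx i) (u2xx i)).
    exact: (@continuous_affine R 'rV[R]_n _ _ x a b 0
      (flow_cont_xx U1 i t0 x) (flow_cont_xx U2 i t0 x)).
  + move=> t x t0.
    have -> : (fun z : R * 'rV[R]_n => a * u1t z.1 z.2 + b * u2t z.1 z.2) =
        (fun z : R * 'rV[R]_n => a * u1t z.1 z.2 + b * u2t z.1 z.2 + 0).
      by apply/funext => z; rewrite addr0.
    apply: (@continuous_affine R (R * 'rV[R]_n)%type (fun z => u1t z.1 z.2)
      (fun z => u2t z.1 z.2) (t, x)).
      exact: (flow_cont_t U1).
    exact: (flow_cont_t U2).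
  + move=> t x t0; rewrite (flow_heat U1)// (flow_heat U2)// !mulr_sumr.
    by rewrite -big_split.
Qed.

(** At a positive time the solution is Lipschitz in time, uniformly on the
    cube, which gives the attainment of u(s) in L^1. *)
Lemma heat_flow_shift (R : realType) (n : nat) (v : 'rV[R]_n -> R)
    (u : R -> 'rV[R]_n -> R) (s : R) :
  heat_flow v u -> 0 <= s -> heat_flow (u s) (fun t => u (s + t)).
Proof.
move=> uv; rewrite le_eqVlt => /predU1P[<-|s0].
  rewrite (heat_flow0 uv) (_ : (fun t => u (0 + t)) = u)//.
  by apply/funext => t; rewrite add0r.
have [ut [ux [uxx U]]] := heat_flow_smooth uv.
have st0 (t : R) : 0 < t -> 0 < s + t by move=> t0; rewrite addr_gt0.
split.
- by apply/Lfun1_integrable; exact: heat_flow_integrable uv (ltW s0).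
- by rewrite addr0.
- move=> e e0.
  have [K utK] := flow_dt_bounded U (s + 1) s0.
  pose V := volume_root n (1%:E : \bar R).
  have V0 : 0 <= V := volume_root_ge0 _ _.
  have den : 0 < `|K| * V + 1 by rewrite ltr_wpDl// mulr_ge0.
  exists (Num.min 1 (e / (`|K| * V + 1))).
    by rewrite lt_min ltr01 divr_gt0.
  move=> t /andP[t0]; rewrite lt_min => /andP[t1 te].
  apply: Lp_ball_le (_ : `|K * t| * V <= e) _.
    rewrite normrM (gtr0_norm t0) -mulrA [t * _]mulrC mulrA.
    rewrite (le_trans (y := (`|K| * V + 1) * t))//.
      by rewrite ler_wpM2r ?lerDl// ltW.
    by rewrite mulrC -ler_pdivlMr// ltW.
  apply: (@Lp_ball_norm_le R n 1 (lexx _) _ (fun=> K * t)); last first.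
  - exact: Lp_ball_cst.
  - apply: filterS (ae_cube R n) => x Qx.
    have sst : s <= s + t by rewrite lerDl ltW.
    have -> : K * t = K * (s + t - s) by rewrite addrAC subrr add0r.
    rewrite (le_trans _ (ler_norm _))//.
    apply: (@le_increment_derive R (u^~ x) (ut^~ x)) => //.
      by move=> r /andP[sr _]; apply: (flow_dt U); rewrite (lt_le_trans s0).
    move=> r /andP[sr rst]; apply: utK => //.
    by rewrite in_itv/= sr (le_trans rst)// lerD2l ltW.
  apply: measurable_funB; apply: (heat_flow_measurable uv).
    by rewrite ltW// st0.
  exact: ltW.
- exists (fun t => ut (s + t)), (fun i t => ux i (s + t)),
    (fun i t => uxx i (s + t)).
  split.
  + by move=> t x i t0; rewrite (flow_periodic U)// st0.
  + move=> t x t0; apply: is_derive_line (flow_dt U x (st0 t t0)) => h /=.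
    by rewrite addrCA.
  + by move=> t x i t0; have := flow_dx U x i (st0 t t0).
  + by move=> t x i t0; have := flow_dxx U x i (st0 t t0).
  + by move=> t t0; exact: (flow_cont U (st0 t t0)).
  + by move=> t i t0; exact: (flow_cont_x U i (st0 t t0)).
  + by move=> t i t0; exact: (flow_cont_xx U i (st0 t t0)).
  + move=> t x t0 A /(flow_cont_t U (st0 t t0)) /nbhs_ballP[e /= e0 eA].
    apply/nbhs_ballP; exists e => //= -[r y] [/= tr xy].
    apply: (eA (s + r, y)); split => //=.
    by move: tr; rewrite -!ball_normE/= opprD addrACA subrr add0r.
  + by move=> t x t0; rewrite (flow_heat U)// st0.
Qed.


(** * The heat flow contracts every L^p norm *)

Lemma heat_flow_affine_ge0 (R : realType) (n : nat) (v1 v2 : 'rV[R]_n -> R)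
    (u1 u2 : R -> 'rV[R]_n -> R) (a b c t : R) :
  heat_flow v1 u1 -> heat_flow v2 u2 -> 0 <= t ->
  {ae torus_measure n, forall x, 0 <= a * v1 x + b * v2 x + c} ->
  {ae torus_measure n, forall x, 0 <= a * u1 t x + b * u2 t x + c}.
Proof.
move=> f1 f2 t0 h.
exact: (heat_flow_ge0 (heat_flow_affine a b c f1 f2) h t0).
Qed.

(** By Young's inequality the affine functions s |-> b s - b^q' / q' lie below
    s^q / q, and b = s^(q - 1) makes them meet at s. Rational slopes suffice
    by continuity; a countable family is needed because each inequality will
    be known only almost everywhere. *)
Lemma powR_le_of_tangents (R : realType) (q q' s y : R) :
  1 < q -> 0 < q' -> q^-1 + q'^-1 = 1 -> 0 <= s ->
  (forall r : rat, `|ratr r| * s <= y / q + `|ratr r| `^ q' / q') -> s `^ q <= y.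
Proof.
move=> q1 q'0 qq' s0 H.
have q0 : 0 < q by rewrite (lt_trans ltr01).
move: s0; rewrite le_eqVlt => /predU1P[s0|s0].
  rewrite -s0 powR0 ?gt_eqF//; have := H 0.
  rewrite raddf0 normr0 mul0r powR0 ?gt_eqF// mul0r addr0.
  by rewrite pmulr_lge0// invr_gt0.
rewrite leNgt; apply/negP => ys.
pose b0 := s `^ (q - 1).
have b00 : 0 < b0 by exact: powR_gt0.
pose g b := b * s - (y / q + b `^ q' / q').
have gb0 : 0 < g b0.
  have b0s : b0 * s = s `^ q.
    by rewrite /b0 -{2}[s]powRr1 ?ltW// -powRD ?subrK// gt_eqF ?implybT.
  have qq'1 : (q - 1) * q' = q.
    have : (q^-1 + q'^-1) * (q * q') = q' + q by field; rewrite !gt_eqF.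
    by rewrite qq' mul1r => qq; rewrite mulrBl mul1r qq [q' + q]addrC addrK.
  have b0q : b0 `^ q' = s `^ q by rewrite /b0 -powRrM qq'1.
  rewrite /g b0s b0q.
  have -> : s `^ q - (y / q + s `^ q / q') =
      (s `^ q - y) / q + s `^ q * (1 - (q^-1 + q'^-1)) by ring.
  by rewrite qq' subrr mulr0 addr0 divr_gt0// subr_gt0.
have cg : {for b0, continuous g}.
  apply: cvgB; first by apply: cvgM; [exact: cvg_id|exact: cvg_cst].
  apply: cvgD; first exact: cvg_cst.
  apply: cvgM; last exact: cvg_cst.
  have [/derivable1_diffP/differentiable_continuous cp _] :=
    is_derive1_powR q' b00.
  exact: cp.
have [e e0 He] : exists2 e : R, 0 < e &
    forall b, `|b0 - b| < e -> 0 < b /\ 0 < g b.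
  move/cvgrPdist_lt : cg => /(_ _ gb0)/nbhs_ballP[e /= e0 He].
  exists (Num.min e b0) => [|b]; first by rewrite lt_min e0.
  rewrite lt_min => /andP[be bb0]; split.
    by move: bb0; rewrite ltr_norml => /andP[_]; lra.
  by have := He b be; rewrite ltr_norml => /andP[_]; lra.
have [|r] := @rat_in_itvoo R b0 (b0 + e); first by rewrite ltrDl.
rewrite in_itv/= => /andP[br rb].
have [|r0 gr] := He (ratr r).
  by rewrite distrC gtr0_norm ?subr_gt0// ltrBlDl.
have := H r; rewrite gtr0_norm//.
by apply/negP; rewrite -ltNge -subr_gt0.
Qed.

(** Jensen's argument, with E_A(t)|v|^q in place of the conditional
    expectation. For q = 1 the modulus is its own tangent, and for the
    supremum norm a constant is compared with u. *)
Lemma heat_flow_Lp_contraction (R : realType) (n : nat)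
    (EA : R -> ('rV[R]_n -> R) -> 'rV[R]_n -> R) (p : \bar R) (r t : R)
    (v : 'rV[R]_n -> R) (u : R -> 'rV[R]_n -> R) :
  heat_semigroup EA -> (1 <= p)%E -> heat_flow v u -> 0 <= t ->
  Lp_ball p r v -> Lp_ball p r (u t).
Proof.
move=> EAh p1 uv t0 vr; apply/Lp_ballP.
have mu_u := heat_flow_measurable uv t0; split=> //.
move: vr => [vp]; rewrite /Lp_norm.
case: p p1 vp => [q| |//] p1 vp; last first.
  rewrite unlock torus_measure_gt0 => /ess_supP vr; apply/ess_supP.
  have up_le (s : R) : `|s| = 1 ->
      {ae torus_measure n, forall x, 0 <= (- s) * u t x + 0 * u t x + r}.
    move=> s1; apply: (heat_flow_affine_ge0 uv uv t0).
    apply: filterS vr => x /=; rewrite lee_fin => vxr.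
    rewrite mul0r addr0 mulNr addrC subr_ge0.
    by rewrite (le_trans (ler_norm _))// normrM s1 mul1r.
  apply: filterS2 (up_le 1 (normr1 _)) (up_le (-1) (normrN1 _)) => x /=.
  move=> h1 h2; rewrite lee_fin ler_norml; move: h1 h2; rewrite !mul0r => h1 h2.
  by apply/andP; split; lra.
rewrite lee_fin in p1; rewrite unlock => vr; apply: le_trans vr.
have q0 : 0 < q by rewrite (lt_le_trans ltr01).
pose V x := `|v x| `^ q.
have iV : (torus_measure n).-integrable setT (EFin \o V).
  exact: Lfun_integrable p1 vp.
have UV : heat_flow V (EA^~ V).
  have V1 : V \in Lfun (torus_measure n) 1 by exact/Lfun1_integrable.
  exact: heat_solution_flow V1 (EAh V V1).
pose U := EA t V.
have iU : (torus_measure n).-integrable setT (EFin \o U).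
  exact: heat_flow_integrable UV t0.
have tangent (b c : R) : 0 <= b -> (forall x, b * `|v x| <= V x / q + c) ->
    {ae torus_measure n, forall x, b * `|u t x| <= U x / q + c}.
  move=> b0 bv.
  have sgn (s : R) : `|s| = 1 ->
      {ae torus_measure n, forall x, 0 <= (- (b * s)) * u t x + q^-1 * U x + c}.
    move=> s1; apply: (heat_flow_affine_ge0 uv UV t0).
    apply: nearW => x; have := bv x; rewrite [_ / q]mulrC mulNr.
    have : b * s * v x <= b * `|v x|.
      rewrite -mulrA ler_wpM2l// (le_trans (ler_norm _))//.
      by rewrite normrM s1 mul1r.
    lra.
  apply: filterS2 (sgn 1 (normr1 _)) (sgn (-1) (normrN1 _)) => x.
  rewrite -/U [_ / q]mulrC !mulrN !mulr1 opprK.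
  by case: (ler0P (u t x)); rewrite mulNr ?mulrN; lra.
have uU : {ae torus_measure n, forall x, `|u t x| `^ q <= U x}.
  move: p1; rewrite le_eqVlt => /predU1P[q1|q1].
    have : {ae torus_measure n, forall x, 1 * `|u t x| <= U x / q + 0}.
      by apply: tangent => // x; rewrite /V -q1 divr1 mul1r addr0 powRr1.
    by apply: filterS => x; rewrite -q1 mul1r divr1 addr0 powRr1.
  pose q' := (1 - q^-1)^-1.
  have q'0 : 0 < q' by rewrite invr_gt0 subr_gt0 invf_lt1.
  have qq' : q^-1 + q'^-1 = 1 by rewrite invrK addrC subrK.
  pose b k : R := `|ratr (odflt 0 (unpickle k))|.
  have : {ae torus_measure n,
      forall x k, b k * `|u t x| <= U x / q + b k `^ q' / q'}.
    apply: ae_foralln => k; apply: tangent; first exact: normr_ge0.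
    move=> x; rewrite mulrC; apply: conjugate_powR => //; exact: normr_ge0.
  apply: filterS => x H.
  apply: (powR_le_of_tangents q1 q'0 qq' (normr_ge0 _)) => s.
  by have := H (pickle s); rewrite /b pickleK.
apply: gt0_ler_poweR.
- by rewrite invr_ge0 ltW.
- rewrite in_itv/= leey andbT; apply: integral_ge0 => x _.
  by rewrite lee_fin powR_ge0.
- rewrite in_itv/= leey andbT; apply: integral_ge0 => x _.
  by rewrite lee_fin powR_ge0.
have UabsE : (\int[torus_measure n]_x `|U x|%:E =
    \int[torus_measure n]_x (U x)%:E)%E.
  apply: ae_eq_integral => //.
  - by have /measurable_int := integrable_norm iU.
  - by have /measurable_int := iU.
  - apply: filterS uU => x uUx _; rewrite ger0_norm//.
    by rewrite (le_trans _ uUx)// powR_ge0.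
apply: (@le_trans _ _ (\int[torus_measure n]_x (U x)%:E)%E).
  rewrite -UabsE; apply: ae_ge0_le_integral => //.
  - by move=> x _; rewrite /= lee_fin powR_ge0.
  - apply/measurable_EFinP.
    apply: (@measurableT_comp _ _ _ _ _ _ (@powR R ^~ q)) => //.
    exact: measurableT_comp.
  - by have /measurable_int := integrable_norm iU.
  - apply: filterS uU => x uUx _; rewrite /= lee_fin.
    by rewrite (le_trans uUx)// ler_norm.
have := heat_flow_mass_le UV t0; rewrite -lee_fin /Rintegral !fineK//.
- exact: (integrable_fin_num _ iV).
- exact: (integrable_fin_num _ iU).
Qed.


(** * The pointwise flow of w' = f(w) *)

(** Gronwall's argument for the increment q = y - y(0): with
    A = |y(0)| + h, the function exp(-kt) (|q| + A) does not increase. As |q|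
    need not be differentiable where q vanishes, it is replaced by
    sqrt(e^2 + q^2), and e tends to 0 at the end. *)
Lemma gronwall_increment (R : realType) (y dy : R -> R) (k h : R) :
  0 < k -> 0 <= h ->
  {within `[0, +oo[, continuous y} ->
  (forall t : R, 0 < t -> is_derive t 1 y (dy t)) ->
  (forall t, 0 < t -> `|dy t| <= k * (`|y t| + h)) ->
  forall t, 0 <= t -> `|y t - y 0| <= (expR (k * t) - 1) * (`|y 0| + h).
Proof.
move=> k0 h0 cy dyt dyle t; rewrite le_eqVlt => /predU1P[<-|t0].
  by rewrite subrr normr0 mulr0 expR0 subrr mul0r.
pose A := `|y 0| + h.
have A0 : 0 <= A by rewrite addr_ge0.
suff H (e : R) : 0 < e -> `|y t - y 0| + A <= expR (k * t) * (e + A).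
  have -> : (expR (k * t) - 1) * A = expR (k * t) * A - A by ring.
  rewrite lerBrDr; apply/ler_addgt0Pr => e e0.
  have E0 := expR_gt0 (k * t).
  have := H (e / expR (k * t)) (divr_gt0 e0 E0).
  by rewrite mulrDr mulrCA divff ?gt_eqF// mulr1 [e + _]addrC.
move=> e0; have e20 : 0 < e ^+ 2 by rewrite exprn_gt0.
pose q s := y s - y 0.
pose S z := Num.sqrt (e ^+ 2 + z ^+ 2).
pose W s := expR (- (k * s)) * (S (q s) + A).
pose dW s := expR (- (k * s)) * (q s / S (q s) * dy s - k * (S (q s) + A)).
have S_gt0 z : 0 < S z by rewrite sqrtr_gt0 ltr_wpDr// sqr_ge0.
have dWs (s : R) : 0 < s -> is_derive s 1 W (dW s).
  move=> s0.
  have dq : is_derive s 1 q (dy s).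
    have H := is_deriveB (dyt s s0) (is_derive_cst (y 0) s 1).
    by apply: (is_derive_eq H); rewrite subr0.
  have dSq := @is_derive1_comp R S q s _ _ (is_derive_smooth_abs e20 (q s)) dq.
  have dSA := is_deriveD dSq (is_derive_cst A s 1).
  have dk : is_derive s 1 (fun s => - (k * s)) (- k).
    have H := is_deriveN (is_deriveZ k (is_derive_id s 1)).
    by apply: (is_derive_eq H); rewrite -[k *: 1]/(k * 1) mulr1.
  have dE := @is_derive1_comp R expR (fun s => - (k * s)) s _ _
    (is_derive_expR _) dk.
  have dM := is_deriveM dE dSA.
  apply: (is_derive_eq dM).
  by rewrite /dW -![_ *: _]/(_ * _) !fctE /=; ring.
have dW_le0 s : 0 < s -> dW s <= 0.
  move=> s0; rewrite /dW mulr_ge0_le0 ?expR_ge0// subr_le0.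
  apply: le_trans (ler_norm _) _; rewrite normrM.
  have qS : `|q s| <= S (q s) := smooth_abs_ge e20 (q s).
  have dys : `|dy s| <= k * (`|q s| + A).
    rewrite (le_trans (dyle s s0))// ler_wpM2l ?(ltW k0)// addrA lerD2r.
    by rewrite -{1}[y s](subrK (y 0)) ler_normD.
  rewrite (le_trans (y := 1 * (k * (`|q s| + A))))//.
    by rewrite ler_pM// smooth_sign_le1.
  by rewrite mul1r ler_wpM2l ?(ltW k0)// lerD2r.
have cW : {within `[0, t], continuous W}.
  have c0t : {within `[0, t], continuous y}.
    apply: continuous_subspaceW cy => s /=.
    by rewrite !in_itv/= andbT => /andP[].
  have cS : continuous S := is_derive_continuous (is_derive_smooth_abs e20).
  have cE : continuous (fun s : R => expR (- (k * s))).
    move=> s; apply: (@continuous_comp R R R (fun s => - (k * s)) expR).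
      by apply: cvgN; apply: cvgM; [exact: cvg_cst|exact: cvg_id].
    exact: continuous_expR.
  move=> s; apply: cvgM; first exact: (continuous_subspaceT cE).
  apply: cvgD; last exact: cvg_cst.
  apply: continuous_cvg; first exact: cS.
  by apply: cvgB; [exact: c0t|exact: cvg_cst].
have : W t <= W 0.
  apply: (@ler0_derive1_le_cc R W 0 t) => //.
  - by move=> s; rewrite in_itv/= => /andP[s0 _]; have [] := dWs s s0.
  - move=> s; rewrite in_itv/= => /andP[s0 _]; rewrite derive1E.
    by have [_ ->] := dWs s s0; exact: dW_le0.
  - by rewrite in_itv/= lexx ltW.
  - by rewrite in_itv/= lexx ltW.
  - exact: ltW.
have -> : W 0 = e + A.
  rewrite /W mulr0 oppr0 expR0 mul1r /S /q subrr expr0n addr0.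
  by rewrite sqrtr_sqr gtr0_norm.
rewrite /W expRN mulrC ler_pdivrMr ?expR_gt0// mulrC.
by apply: le_trans; rewrite lerD2r; exact: smooth_abs_ge e20 (q t).
Qed.

Section pointwise_flow.
Context (R : realType) (n : nat) (f : R -> R) (k : R) (k0 : 0 < k).
Hypothesis f_diff : forall xi, derivable f xi 1.
Hypothesis f_bound : forall xi, `|derive1 f xi| <= k.
Variable EB : R -> ('rV[R]_n -> R) -> 'rV[R]_n -> R.
Hypothesis EB_flow : pointwise_flow f EB.

Let f_lip a b : `|f a - f b| <= k * `|a - b|.
Proof.
apply: (@lipschitz_derive R f (derive1 f)) => // xi.
by split; [exact: f_diff|rewrite derive1E].
Qed.

Lemma ode_flow_increment (y0 : R) (y : R -> R) (t : R) :
  ode_solution f y0 y -> 0 <= t ->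
  `|y t - y0| <= (expR (k * t) - 1) * (`|y0| + `|f 0| / k).
Proof.
move=> [<- cy dy] t0.
apply: (@gronwall_increment R y (f \o y)) => //.
  by rewrite divr_ge0// ltW.
move=> s s0 /=; rewrite mulrDr mulrCA divff ?gt_eqF// mulr1.
have := f_lip (y s) 0; rewrite subr0 => H.
by rewrite -[f (y s)](subrK (f 0)) (le_trans (ler_normD _ _))// lerD2r.
Qed.

Lemma ode_flow_diff_increment (y0 z0 : R) (y z : R -> R) (t : R) :
  ode_solution f y0 y -> ode_solution f z0 z -> 0 <= t ->
  `|(y t - z t) - (y0 - z0)| <= (expR (k * t) - 1) * `|y0 - z0|.
Proof.
move=> [<- cy dy] [<- cz dz] t0.
have := @gronwall_increment R (fun s => y s - z s) (fun s => f (y s) - f (z s))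
  k 0 k0 (lexx _) _ _ _ t t0.
rewrite addr0; apply.
- by move=> s; apply: cvgB; [exact: cy|exact: cz].
- by move=> s s0; exact: is_deriveB (dy s s0) (dz s s0).
- by move=> s s0; rewrite addr0.
Qed.

(** Solutions are unique, so the flow factors through a function of the
    initial value alone; that function is Lipschitz, hence Borel. *)
Lemma pointwise_flow_measurable (t : R) (w : 'rV[R]_n -> R) : 0 <= t ->
  measurable_fun setT w -> measurable_fun setT (EB t w).
Proof.
move=> t0 mw; pose Phi y0 := EB t (fun=> y0) 0.
have -> : EB t w = Phi \o w.
  apply/funext => x; have := ode_flow_diff_increment (EB_flow w x)
    (EB_flow (fun=> w x) 0) t0.
  by rewrite subrr normr0 mulr0 subr0 normr_le0 subr_eq0 => /eqP.
apply: measurableT_comp mw.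
have Phi_lip a b : `|Phi a - Phi b| <= expR (k * t) * `|a - b|.
  have := ode_flow_diff_increment (EB_flow (fun=> a) 0) (EB_flow (fun=> b) 0) t0.
  rewrite -/(Phi a) -/(Phi b) => H.
  rewrite -[Phi a - Phi b](subrK (a - b)) (le_trans (ler_normD _ _))//.
  by rewrite (le_trans (lerD H (lexx _)))// mulrBl mul1r subrK.
apply: continuous_measurable_fun => a; apply/cvgrPdist_lt => e e0.
have E0 := expR_gt0 (k * t).
near=> b; rewrite (le_lt_trans (Phi_lip _ _))// mulrC -ltr_pdivlMr//; near: b.
by apply: cvgr_dist_lt => //; rewrite divr_gt0.
Unshelve. all: by end_near. Qed.

End pointwise_flow.


(** * Stability of the splitting operator *)

(** Bernoulli's inequality for the power c of exp x: split off one factor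
    exp x and use exp y >= 1 + y at y = (c - 1) x and at y = -x. *)
Lemma bernoulli_expR (R : realType) (c x : R) : 1 <= c -> 0 <= x ->
  1 + c * (expR x - 1) <= expR (c * x).
Proof.
move=> c1 x0; have e0 := expR_gt0 x.
have -> : c * x = x + (c - 1) * x by ring.
have h1 : expR x * (1 + (c - 1) * x) <= expR (x + (c - 1) * x).
  by rewrite expRD ler_wpM2l ?expR_ge0// expR_ge1Dx.
have h2 : expR x - 1 <= expR x * x.
  have := ler_wpM2l (ltW e0) (expR_ge1Dx (- x)).
  by rewrite expRN mulfV ?gt_eqF//; lra.
have h3 : (c - 1) * (expR x - 1) <= (c - 1) * (expR x * x).
  by rewrite ler_wpM2l// subr_ge0.
by apply: le_trans h1; lra.
Qed.

(** The invariant carried along one product of the expansion, after heat time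
    [A] and reaction time [B]. A value f(0) <> 0 makes the growth of norms
    affine; it becomes exponential once norms are shifted by the norm of the
    constant [h] = |f(0)|/k, and [K] is the shifted initial norm. *)
Definition tracks (R : realType) (n : nat) (p : \bar R) (k h K : R)
    (u0 : R -> 'rV[R]_n -> R) (A B : R) (g : 'rV[R]_n -> R) : Prop :=
  Lp_ball p (expR (k * B) * K - h * volume_root n p) g /\
  Lp_ball p ((expR (k * B) - 1) * K) (fun x => g x - u0 A x).

Lemma tracks_init (R : realType) (n : nat) (p : \bar R) (k h r : R)
    (u0 : R -> 'rV[R]_n -> R) (g : 'rV[R]_n -> R) :
  (1 <= p)%E -> u0 0 = g -> Lp_ball p r g ->
  tracks p k h (r + h * volume_root n p) u0 0 0 g.
Proof.
move=> p1 u0g gr; split; rewrite mulr0 expR0 ?mul1r ?addrK//.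
rewrite subrr mul0r u0g; under eq_fun do rewrite subrr.
by have := Lp_ball_cst n p1 0; rewrite normr0 mul0r.
Qed.

Lemma heat_flow_sub (R : realType) (n : nat) (v1 v2 : 'rV[R]_n -> R)
    (u1 u2 : R -> 'rV[R]_n -> R) :
  heat_flow v1 u1 -> heat_flow v2 u2 ->
  heat_flow (fun x => v1 x - v2 x) (fun t x => u1 t x - u2 t x).
Proof.
move=> f1 f2; have := heat_flow_affine 1 (-1) 0 f1 f2.
have E (x y : R) : 1 * x + -1 * y + 0 = x - y by ring.
congr heat_flow; first by apply/funext => x.
by apply/funext => t; apply/funext => x.
Qed.

Section splitting.
Context (R : realType) (n : nat) (p : \bar R) (p1 : (1 <= p)%E).
Context (f : R -> R) (k : R) (k0 : 0 < k).
Hypothesis f_diff : forall xi, derivable f xi 1.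
Hypothesis f_bound : forall xi, `|derive1 f xi| <= k.
Variables EA EB : R -> ('rV[R]_n -> R) -> 'rV[R]_n -> R.
Hypothesis EA_heat : heat_semigroup EA.
Hypothesis EB_flow : pointwise_flow f EB.
Notation V := (volume_root n p).

Let V0 : 0 <= V := volume_root_ge0 n p.

Lemma heat_flow_EA r w : Lp_ball p r w -> heat_flow w (EA^~ w).
Proof.
move=> wr; have w1 := Lp_ball_Lfun1 p1 wr.
exact: heat_solution_flow w1 (EA_heat w1).
Qed.

Section tracking.
Context (h K : R) (h0 : 0 <= h) (g0 : 'rV[R]_n -> R) (u0 : R -> 'rV[R]_n -> R).
Hypothesis u0_flow : heat_flow g0 u0.

(** The deviation is the value at time [a] of the heat flow u - u0(A + .),
    whose initial value is the deviation before the step; so neither bound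
    worsens. *)
Lemma tracks_heat (A B a : R) (g : 'rV[R]_n -> R) (u : R -> 'rV[R]_n -> R) :
  0 <= A -> 0 <= a -> heat_flow g u ->
  tracks p k h K u0 A B g -> tracks p k h K u0 (A + a) B (u a).
Proof.
move=> A0 a0 gu [gB gD]; split.
  exact: (heat_flow_Lp_contraction EA_heat p1 gu a0 gB).
have duA := heat_flow_sub gu (heat_flow_shift u0_flow A0).
exact: (heat_flow_Lp_contraction EA_heat p1 duA a0 gD).
Qed.

Lemma tracks_reaction (A B b : R) (g g' : 'rV[R]_n -> R) : 0 <= b ->
  measurable_fun setT g' ->
  (forall x, `|g' x - g x| <= (expR (k * b) - 1) * (`|g x| + h)) ->
  tracks p k h K u0 A B g -> tracks p k h K u0 A (B + b) g'.
Proof.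
move=> b0 mg' gg' [gB gD].
have [mg _] := (Lp_ballP _ _ _).1 gB.
have eb0 : 0 <= expR (k * b) - 1.
  by rewrite subr_ge0 -expR0 ler_expR mulr_ge0// ltW.
have dB : Lp_ball p ((expR (k * b) - 1) * (expR (k * B) * K))
    (fun x => g' x - g x).
  have gN : Lp_ball p (expR (k * B) * K - h * V) (fun x => `|g x|).
    apply: Lp_ball_norm_le gB => //; first exact: measurableT_comp.
    by apply: nearW => x; rewrite normr_id.
  have := Lp_ballZ p1 (expR (k * b) - 1) (Lp_ballD p1 gN (Lp_ball_cst n p1 h)).
  rewrite (ger0_norm h0) (ger0_norm eb0) subrK.
  apply: Lp_ball_norm_le => //; first exact: measurable_funB.
  apply: nearW => x; rewrite (le_trans (gg' x))//; exact: ler_norm.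
have eBb : expR (k * (B + b)) = expR (k * b) * expR (k * B).
  by rewrite -expRD; congr expR; ring.
split.
  have := Lp_ballD p1 gB dB.
  under eq_fun do rewrite addrC subrK.
  by apply: Lp_ball_le; rewrite eBb; lra.
have := Lp_ballD p1 gD dB.
rewrite (_ : (fun x => _) = (fun x => g' x - u0 A x)); last first.
  by apply/funext => x; ring.
by apply: Lp_ball_le; rewrite eBb; lra.
Qed.

End tracking.

Let h := `|f 0| / k.
Let h0 : 0 <= h. Proof. by rewrite divr_ge0// ltW. Qed.

Section fold.
Context (m : nat) (a b : 'I_m -> R) (tau : R) (tau0 : 0 <= tau).
Hypothesis a_ge0 : forall j, 0 <= a j.
Hypothesis b_ge0 : forall j, 0 <= b j.
Let step (v : 'rV[R]_n -> R) j := EB (b j * tau) (EA (a j * tau) v).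

Lemma tracks_fold (K : R) (g0 : 'rV[R]_n -> R) (u0 : R -> 'rV[R]_n -> R)
    (s : seq 'I_m) (A B : R) (w : 'rV[R]_n -> R) :
  heat_flow g0 u0 -> 0 <= A -> tracks p k h K u0 A B w ->
  tracks p k h K u0 (A + \sum_(j <- s) a j * tau) (B + \sum_(j <- s) b j * tau)
    (foldl step w s).
Proof.
move=> u0f; elim: s A B w => [|j s IHs] A B w A0 wT /=.
  by rewrite !big_nil !addr0.
rewrite !big_cons !addrA.
have aj : 0 <= a j * tau by rewrite mulr_ge0.
have bj : 0 <= b j * tau by rewrite mulr_ge0.
apply: IHs; first by rewrite addr_ge0.
have wf := heat_flow_EA wT.1.
apply: tracks_reaction (tracks_heat u0f A0 aj wf wT) => //.
- apply: (pointwise_flow_measurable k0 f_diff f_bound EB_flow bj).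
  exact: heat_flow_measurable wf aj.
- by move=> x; exact: (ode_flow_increment k0 f_diff f_bound (EB_flow _ x) bj).
Qed.

(** The shift [h] is 0 here: a difference of two reaction flows moves by a
    multiple of itself, whatever f(0) is. *)
Lemma tracks_fold_diff (K : R) (g0 : 'rV[R]_n -> R) (u0 : R -> 'rV[R]_n -> R)
    (s : seq 'I_m) (A B rw rv : R) (w v : 'rV[R]_n -> R) :
  heat_flow g0 u0 -> 0 <= A -> Lp_ball p rw w -> Lp_ball p rv v ->
  tracks p k 0 K u0 A B (fun x => w x - v x) ->
  tracks p k 0 K u0 (A + \sum_(j <- s) a j * tau) (B + \sum_(j <- s) b j * tau)
    (fun x => foldl step w s x - foldl step v s x).
Proof.
move=> u0f; elim: s A B rw rv w v => [|j s IHs] A B rw rv w v A0 wB vB wvT /=.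
  by rewrite !big_nil !addr0.
rewrite !big_cons !addrA.
have aj : 0 <= a j * tau by rewrite mulr_ge0.
have bj : 0 <= b j * tau by rewrite mulr_ge0.
(* Each trajectory, tracked along its own heat flow, stays in L^p. *)
have stepB r y : Lp_ball p r y -> exists r', Lp_ball p r' (step y j).
  move=> yB; have yT : tracks p k h (r + h * V) (EA^~ y) 0 0 y.
    exact: tracks_init p1 (heat_flow0 (heat_flow_EA yB)) yB.
  have [+ _] := tracks_fold [:: j] (heat_flow_EA yB) (lexx 0) yT.
  by move=> /= ?; eexists; eassumption.
have [rw' wB'] := stepB _ _ wB; have [rv' vB'] := stepB _ _ vB.
apply: IHs wB' vB' _; first by rewrite addr_ge0.
have wf := heat_flow_EA wB; have vf := heat_flow_EA vB.
have wvaT := tracks_heat u0f A0 aj (heat_flow_sub wf vf) wvT.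
have mstep y : heat_flow y (EA^~ y) -> measurable_fun setT (step y j).
  move=> yf; apply: (pointwise_flow_measurable k0 f_diff f_bound EB_flow bj).
  exact: heat_flow_measurable yf aj.
apply: tracks_reaction wvaT => //.
- by apply: measurable_funB; exact: mstep.
- move=> x; rewrite addr0.
  exact: (ode_flow_diff_increment k0 f_diff f_bound
    (EB_flow _ x) (EB_flow _ x) bj).
Qed.

End fold.

Section expansion.
Context (M : nat) (m : 'I_M -> nat) (c : 'I_M -> R).
Variables a b : forall i : 'I_M, 'I_(m i) -> R.
Hypothesis a_ge0 : forall i j, 0 <= @a i j.
Hypothesis b_ge0 : forall i j, 0 <= @b i j.
Hypothesis c_sum : \sum_(i < M) c i = 1.
Hypothesis a_sum : forall i, \sum_(j < m i) @a i j = 1.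
Let ctilde := \sum_(i < M) `|c i|.
Let bmax := \big[Num.max/0]_(i < M) \sum_(j < m i) @b i j.

Let bmax_ge0 : 0 <= bmax. Proof. exact: bigmax_ge_id. Qed.

Let ctilde_ge1 : 1 <= ctilde.
Proof. by rewrite -(normr1 R) -c_sum; exact: ler_norm_sum. Qed.

(** Since the weights sum to 1, the expansion is the heat flow plus the
    weighted deviations of the products from it; only the deviations, of size
    exp - 1, are multiplied by the possibly large sum of the |c i|. *)
Lemma tracks_combination (tau h' r : R) (u0 : R -> 'rV[R]_n -> R)
    (g : 'I_M -> 'rV[R]_n -> R) :
  0 <= tau -> 0 <= h' -> Lp_ball p r (u0 tau) ->
  (forall i, tracks p k h' (r + h' * V) u0 tau
    (\sum_(j < m i) @b i j * tau) (g i)) ->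
  Lp_ball p (expR (ctilde * k * bmax * tau) * (r + h' * V) - h' * V)
    (fun x => \sum_(i < M) c i * g i x).
Proof.
move=> tau0 h'0 u0r gT.
set K := r + h' * V in gT *.
have K0 : 0 <= K by rewrite addr_ge0 ?mulr_ge0// (Lp_ball_ge0 u0r).
pose x := k * (bmax * tau).
have x0 : 0 <= x by rewrite !mulr_ge0// ltW.
have devB i : Lp_ball p (`|c i| * ((expR x - 1) * K))
    (fun y => c i * (g i y - u0 tau y)).
  apply: Lp_ballZ => //; have [_] := gT i; apply: Lp_ball_le.
  rewrite ler_wpM2r// lerB// ler_expR /x ler_pM2l// -mulr_suml ler_wpM2r//.
  by rewrite /bmax; exact: le_bigmax.
have := Lp_ballD p1 u0r (Lp_ball_sum p1 (index_enum 'I_M) devB).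
rewrite (_ : (fun y => _) = (fun y => \sum_(i < M) c i * g i y)); last first.
  apply/funext => y; under eq_bigr do rewrite mulrBr.
  by rewrite sumrB -mulr_suml c_sum mul1r addrC subrK.
apply: Lp_ball_le; rewrite -mulr_suml -/ctilde.
have -> : ctilde * k * bmax * tau = ctilde * x by rewrite /x; ring.
have := ler_wpM2r K0 (bernoulli_expR ctilde_ge1 x0).
by rewrite -/ctilde /K; lra.
Qed.

Let S := multi_product EA EB c (@a) (@b).

Let a_time i tau : \sum_(j <- enum 'I_(m i)) @a i j * tau = tau.
Proof. by rewrite big_enum/= -mulr_suml a_sum mul1r. Qed.

Lemma multi_product_growth (tau r : R) (w : 'rV[R]_n -> R) : 0 <= tau ->
  Lp_ball p r w ->
  Lp_ball p (expR (ctilde * k * bmax * tau) * (r + h * V) - h * V) (S tau w).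
Proof.
move=> tau0 wr; have wf := heat_flow_EA wr.
have u0r := heat_flow_Lp_contraction EA_heat p1 wf tau0 wr.
apply: (@tracks_combination tau h r (EA^~ w)) => // i.
have w0 : tracks p k h (r + h * V) (EA^~ w) 0 0 w.
  exact: tracks_init p1 (heat_flow0 wf) wr.
have := tracks_fold tau0 (@a_ge0 i) (@b_ge0 i) (enum 'I_(m i)) wf (lexx 0) w0.
by rewrite !add0r a_time big_enum.
Qed.

Lemma multi_product_diff (tau rw rv r : R) (w v : 'rV[R]_n -> R) : 0 <= tau ->
  Lp_ball p rw w -> Lp_ball p rv v -> Lp_ball p r (fun x => w x - v x) ->
  Lp_ball p (expR (ctilde * k * bmax * tau) * r)
    (fun x => S tau w x - S tau v x).
Proof.
move=> tau0 wB vB wvr.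
have wvf := heat_flow_sub (heat_flow_EA wB) (heat_flow_EA vB).
have u0r := heat_flow_Lp_contraction EA_heat p1 wvf tau0 wvr.
have := @tracks_combination tau 0 r (fun t x => EA t w x - EA t v x) (fun i x =>
  split_product EA EB (@a i) (@b i) tau w x -
  split_product EA EB (@a i) (@b i) tau v x)
  tau0 (lexx 0) u0r.
rewrite mul0r addr0 subr0.
have -> : (fun x => S tau w x - S tau v x) = (fun x => \sum_(i < M) c i *
    (split_product EA EB (@a i) (@b i) tau w x -
     split_product EA EB (@a i) (@b i) tau v x)).
  apply/funext => x; rewrite /S /multi_product -sumrB.
  by apply: eq_bigr => i _; rewrite mulrBr.
apply=> i.
have wv0 : tracks p k 0 r (fun t x => EA t w x - EA t v x) 0 0
    (fun x => w x - v x).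
  by have := tracks_init k 0 p1 (heat_flow0 wvf) wvr; rewrite mul0r addr0.
have := tracks_fold_diff tau0 (@a_ge0 i) (@b_ge0 i) (enum 'I_(m i)) wvf (lexx 0)
  wB vB wv0.
by rewrite !add0r a_time big_enum.
Qed.

Lemma multi_product_iter_growth (tau r : R) (w : 'rV[R]_n -> R) (N : nat) :
  0 <= tau -> Lp_ball p r w ->
  Lp_ball p (expR (ctilde * k * bmax * (N%:R * tau)) * (r + h * V) - h * V)
    (iter N (S tau) w).
Proof.
move=> tau0 wr; elim: N => [|N IHN] /=.
  by rewrite mul0r mulr0 expR0 mul1r addrK.
have := multi_product_growth tau0 IHN; rewrite subrK mulrA -expRD.
by congr (Lp_ball _ (expR _ * _ - _) _); rewrite -natr1; ring.
Qed.

End expansion.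
End splitting.

Theorem theorem4p1 (R : realType) (d : nat) (hd : (1 <= d <= 3)%N)
    (f : R -> R) (kappa : R) (kappa_gt0 : 0 < kappa)
    (f_diff : forall xi, derivable f xi 1)
    (f_bound : forall xi, `|derive1 f xi| <= kappa)
    (EA : R -> ('rV[R]_d -> R) -> ('rV[R]_d -> R)) (EA_heat : heat_semigroup EA)
    (EB : R -> ('rV[R]_d -> R) -> ('rV[R]_d -> R)) (EB_flow : pointwise_flow f EB)
    (p : \bar R) (p_ge1 : (1 <= p)%E)
    (w0 v0 : 'rV[R]_d -> R)
    (w0_Lp : w0 \in Lfun (torus_measure d) p)
    (v0_Lp : v0 \in Lfun (torus_measure d) p)
    (M : nat) (M_gt0 : (0 < M)%N)
    (m : 'I_M -> nat) (m_gt0 : forall i, (0 < m i)%N)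
    (c : 'I_M -> R) (a b : forall i : 'I_M, 'I_(m i) -> R)
    (a_ge0 : forall i j, 0 <= a i j) (b_ge0 : forall i j, 0 <= b i j)
    (c_sum : \sum_(i < M) c i = 1)
    (a_sum : forall i, \sum_(j < m i) a i j = 1) :
  let S := multi_product EA EB c a b in
  let ctilde := \sum_(i < M) `|c i| in
  let bmax := \big[Num.max/0]_(i < M) \sum_(j < m i) b i j in
  let C := (ctilde + 1) * kappa * bmax in
  (forall tau, 0 < tau ->
     (Lp_norm p (S tau w0 \- S tau v0)%R
      <= (expR (C * tau))%:E * Lp_norm p (w0 \- v0)%R)%E) /\
  (forall T tau (n : nat), 0 < T -> 0 < tau -> (0 < n)%N -> n%:R * tau <= T ->
     (Lp_norm p (iter n (S tau) w0)
      <= (expR (ctilde * kappa * bmax * T))%:E *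
         (Lp_norm p w0
          + (volume_root d p * `|f 0| / kappa)%R%:E))%E).
Proof.
move=> S ctilde bmax C.
have bmax0 : 0 <= bmax by exact: bigmax_ge_id.
have k0 := ltW kappa_gt0.
have w0B := Lfun_Lp_ball w0_Lp; have v0B := Lfun_Lp_ball v0_Lp.
split=> [tau tau0|T tau N T0 tau0 N0 NT].
  have [wv_Lp _] := Lp_ballB p_ge1 w0B v0B.
  have wvB := Lfun_Lp_ball wv_Lp.
  have [_] := multi_product_diff p_ge1 kappa_gt0 f_diff f_bound EA_heat EB_flow
    a_ge0 b_ge0 c_sum a_sum (ltW tau0) w0B v0B wvB.
  move=> /le_trans; apply.
  have <- : (fine (Lp_norm p (fun x => w0 x - v0 x)))%:E = Lp_norm p (w0 \- v0).
    rewrite fineK// ge0_fin_numE ?Lnorm_ge0//.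
    by move: wv_Lp => /andP[_ /[!inE]].
  rewrite -EFinM lee_fin.
  apply: ler_wpM2r; first exact: Lp_ball_ge0 wvB.
  rewrite ler_expR.
  rewrite /C -/ctilde -/bmax.
  have := mulr_ge0 (mulr_ge0 k0 bmax0) (ltW tau0); lra.
have [_] := multi_product_iter_growth p_ge1 kappa_gt0 f_diff f_bound EA_heat EB_flow
  a_ge0 b_ge0 c_sum a_sum N (ltW tau0) w0B.
move=> /le_trans; apply.
have <- : (fine (Lp_norm p w0))%:E = Lp_norm p w0.
  rewrite fineK// ge0_fin_numE ?Lnorm_ge0//.
  by move: w0_Lp => /andP[_ /[!inE]].
rewrite -EFinD -EFinM lee_fin.
have V0 : 0 <= volume_root d p := volume_root_ge0 d p.
have h0 : 0 <= `|f 0| / kappa by rewrite divr_ge0.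
set r := fine _; set V := volume_root d p; set h := `|f 0| / kappa.
have r0 : 0 <= r := Lp_ball_ge0 w0B.
rewrite lerBlDr -[_ * `|f 0| / _]mulrA -/h [V * h]mulrC.
rewrite (le_trans (y := expR (ctilde * kappa * bmax * T) * (r + h * V)))//.
  apply: ler_wpM2r; first by rewrite addr_ge0// mulr_ge0.
  rewrite ler_expR; apply: ler_wpM2l NT.
  by rewrite !mulr_ge0// sumr_ge0.
by rewrite lerDl mulr_ge0.
Qed.
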